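(* Let $\epsilon>0$ and $d,k,m\in\mathbb N$. Suppose that $X_1,\dots,X_m$ are jointly independent $dk\times dk$ positive semidefinite random matrices, which take finitely many values and have block diagonal form $$X_i=\begin{bmatrix} X_i^{(1)} & & & \\ & X_i^{(2)} & & \\ & & \ddots & \\ & & & X_i^{(k)}\end{bmatrix},\qquad i=1,\dots,m.$$ Assume that $X_i^{(j)}$, $i=1,\dots,m$, $j=1,\dots,k$, are $d\times d$ positive semidefinite random matrices such that for all $i,j$ $$\sum_{i=1}^m \mathbb E\big[X_i^{(j)}\big]\le \mathbf I_d\qquad\text{and}\qquad \operatorname{tr}(X_i^{(j)})\le\epsilon\ \text{ with probability }1.$$ Then $$\mathbb P\bigg(\bigg\|\sum_{i=1}^m X_i\bigg\|\le 1+2\sqrt{\epsilon k}+\epsilon\bigg)>0.$$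
   Context: Matrices have complex entries; positive semidefinite matrices are Hermitian. $\mathbf I_d$ is the $d\times d$ identity matrix, $\|\cdot\|$ is the operator norm, and $A\le B$ means that $B-A$ is positive semidefinite. *)

(* Defs.v *)
From HB Require Import structures.
From mathcomp Require Import all_boot all_order all_algebra.
From mathcomp Require Import all_classical all_reals all_analysis.
From mathcomp.real_closed Require Import complex.

Set Implicit Arguments.
Unset Strict Implicit.
Unset Printing Implicit Defensive.

Import Order.TTheory GRing.Theory Num.Theory numFieldNormedType.Exports.

Local Open Scope classical_set_scope.
Local Open Scope ring_scope.
Local Open Scope complex_scope.
Local Open Scope sesquilinear_scope.

Section ComplexMatrices.
Context {R : realType}.

(* In the order of R[i], 0 <= z means that z is real and nonnegative. *)
Definition psdmx n (A : 'M[R[i]]_n) : Prop :=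
  A \is hermsymmx /\ forall x : 'cV[R[i]]_n, 0 <= (x^t* *m A *m x) 0 0.

Definition loewner_le n (A B : 'M[R[i]]_n) : Prop := psdmx (B - A).

Definition l2norm n (x : 'cV[R[i]]_n) : R :=
  Num.sqrt (\sum_(a < n) (ComplexField.Normc.normc (x a 0)) ^+ 2).

Definition opnorm n (A : 'M[R[i]]_n) : R :=
  sup [set l2norm (A *m x) | x in [set x : 'cV[R[i]]_n | l2norm x <= 1]].

End ComplexMatrices.

HB.instance Definition _ (R : realType) := isPointed.Build R[i] 0.

(* The Borel sigma-algebra of the space of n x n complex matrices, seen as
   R^(2 n^2): it is generated by the real and imaginary parts of the entries. *)
Definition entry_preimages (R : realType) n : set (set 'M[R[i]]_n) :=
  [set A | exists a b : 'I_n, exists2 B : set R, measurable B &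
     A = (fun M : 'M[R[i]]_n => complex.Re (M a b)) @^-1` B \/
     A = (fun M : 'M[R[i]]_n => complex.Im (M a b)) @^-1` B].

Definition borelmx (R : realType) n :
    measurableType (sigma_display (@entry_preimages R n)) :=
  g_sigma_algebraType (@entry_preimages R n).

Section RandomMatrices.
Context {d : measure_display} {T : measurableType d} {R : realType}.
Variable P : probability T R.

Definition random_mx n (X : T -> 'M[R[i]]_n) : Prop :=
  measurable_fun [set: T] (X : T -> borelmx R n).

Definition expectation_mx n (X : T -> 'M[R[i]]_n) : 'M[R[i]]_n :=
  \matrix_(a, b) (fine 'E_P[fun w => complex.Re (X w a b)] +i*
                  fine 'E_P[fun w => complex.Im (X w a b)])%E.

Definition jointly_independent (I : finType) d' (S : measurableType d')
    (X : I -> T -> S) : Prop :=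
  forall B : I -> set S, (forall i, measurable (B i)) ->
  forall J : {set I},
    P (\bigcap_(i in [set` J]) (X i @^-1` B i)) =
    (\prod_(i in J) P (X i @^-1` B i))%E.

End RandomMatrices.

(* Main.v *)
Require Import Defs.
From HB Require Import structures.
From mathcomp Require Import all_boot all_order all_algebra ring.
From mathcomp Require Import all_classical all_reals all_analysis.
From mathcomp.real_closed Require Import complex.

Set Implicit Arguments.
Unset Strict Implicit.
Unset Printing Implicit Defensive.

Import Order.TTheory GRing.Theory Num.Theory numFieldNormedType.Exports.

(** The method of Marcus, Spielman and Srivastava, at a single point x.  For
    positive definite A_1, ..., A_m let F = prod_i (c_i - D_(A_i)) det, a function
    of the matrix M which is affine in each (c_i, A_i) and does not vanish when M
    has positive definite imaginary part.  Hence, along a positive definite line,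
    D_B F / F is a sum of terms c / (s - r) with c >= 0 and r real; above the
    zeros of F it is nonnegative, decreasing and convex.  This gives the barrier
    argument: started at x - delta sum_i E X_i, it shows that x 1 lies above the
    zeros of F for A_i = E X_i.  Averaging, each E X_i can be replaced in turn by
    some value of X_i so that x 1 stays above the zeros.

    Take x = (1 + sqrt (k eps))^2 and c_i = 1 - (k eps - tr X_i) / x, which has the
    effect of padding the blocks of X_i by spread out ones so that they all have
    trace eps.  In a given block j, the other k - 1 blocks and the padding use up
    (k - 1) eps / x of the potential, and what remains forces
    sum_i X_i^(j) <= x - (k - 1) eps = 1 + 2 sqrt (k eps) + eps. *)

(** Definite directions are what the argument rests on. Along M + s A with A definite, F is a
    polynomial of exact degree n with positive top coefficient and D_B F has smaller degree, so D_B
    F / F is a proper fraction with no polynomial part. Hence the cone attached to M consists of 0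
    and the definite matrices only, a singular direction is used after adding a small multiple of 1,
    and semidefinite values are reached last, by perturbation: there are finitely many selections,
    so one of them survives the limit. The averaging needs no comparison of roots. By linearity the
    averaged function at M is the average of the functions, and a positive value at M alone already
    places M above the zeros. Selected values are kept of positive probability, since the trace
    bound holds only almost surely. Independence enters only at the end, to make the selected values
    occur together. *)

Local Open Scope ring_scope.

(** * Partial fractions of quotients that map the upper half plane to the closed lower one *)

Section PartialFractions.
Variable C : numClosedFieldType.
Implicit Types (prs : seq (C * C)) (P Q : {poly C}).

(** A list of pairs (weight, pole) stands for a sum of terms c / (X - r); [pfnum] and [pfden] write
    it over a common denominator, with repeated poles allowed. *)
Definition pfden prs : {poly C} := \prod_(x <- prs) ('X - x.2%:P).

Fixpoint pfnum prs : {poly C} :=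
  if prs is x :: t then x.1 *: pfden t + ('X - x.2%:P) * pfnum t else 0.

Lemma pfden_cons x t : pfden (x :: t) = ('X - x.2%:P) * pfden t.
Proof. by rewrite /pfden big_cons. Qed.

Lemma pfden_neq0 prs s : {in prs, forall x, s != x.2} -> (pfden prs).[s] != 0.
Proof.
elim: prs => [|x t IH] h; first by rewrite /pfden big_nil hornerC oner_eq0.
rewrite pfden_cons hornerM hornerXsubC mulf_neq0 //.
  by rewrite subr_eq0 h // mem_head.
by apply: IH => y yt; apply: h; rewrite inE yt orbT.
Qed.

Lemma pfnumE prs s : {in prs, forall x, s != x.2} ->
  (pfnum prs).[s] = (pfden prs).[s] * \sum_(x <- prs) x.1 / (s - x.2).
Proof.
elim: prs => [|x t IH] h; first by rewrite big_nil mulr0 horner0.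
have sx : s - x.2 != 0 by rewrite subr_eq0 h // mem_head.
have ht : {in t, forall x, s != x.2} by move=> y yt; apply: h; rewrite inE yt orbT.
rewrite /= pfden_cons !hornerE IH // big_cons.
by field.
Qed.

(** The quotient rule without quotients: the derivative of c / (s - r) is - c / (s - r)^2. *)
Lemma pfnum_wronskian prs s : {in prs, forall x, s != x.2} ->
  (pfnum prs)^`().[s] * (pfden prs).[s] - (pfnum prs).[s] * (pfden prs)^`().[s] =
  - ((pfden prs).[s] ^+ 2 * \sum_(x <- prs) x.1 / (s - x.2) ^+ 2).
Proof.
elim: prs => [|x t IH] h.
  by rewrite big_nil /= derivC /pfden !big_nil derivC !hornerE; ring.
have sx : s - x.2 != 0 by rewrite subr_eq0 h // mem_head.
have ht : {in t, forall x, s != x.2} by move=> y yt; apply: h; rewrite inE yt orbT.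
have e := IH ht.
rewrite /= pfden_cons big_cons derivD derivZ !derivM derivXsubC.
rewrite !(hornerD, hornerM, hornerZ, hornerN, hornerX, hornerC) mul1r.
set D := (pfden t).[s] in e *; set D' := (pfden t)^`().[s] in e *.
set N := (pfnum t).[s] in e *; set N' := (pfnum t)^`().[s] in e *.
set S := \sum_(x <- t) _ in e *.
transitivity (- x.1 * D ^+ 2 + (s - x.2) ^+ 2 * (N' * D - N * D')); first by ring.
by rewrite e; field.
Qed.

Lemma pfden_ge0 prs s : {in prs, forall x, x.2 <= s} -> 0 <= (pfden prs).[s].
Proof.
move=> h; rewrite /pfden horner_prod; rewrite big_seq; apply: prodr_ge0 => x xp.
by rewrite hornerXsubC subr_ge0 h.
Qed.

Lemma pfnum_ge0 prs s : {in prs, forall x, 0 <= x.1} ->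
  {in prs, forall x, x.2 <= s} -> 0 <= (pfnum prs).[s].
Proof.
elim: prs => [|x t IH] h1 h2; first by rewrite horner0.
have xin : x \in x :: t by rewrite mem_head.
have sub : {subset t <= x :: t} by move=> y yt; rewrite inE yt orbT.
rewrite /= !hornerE; apply: addr_ge0; apply: mulr_ge0.
- exact: h1.
- by apply: pfden_ge0 => y /sub /h2.
- by rewrite subr_ge0 h2.
- by apply: IH => y /sub; [apply: h1 | apply: h2].
Qed.

(** The weight of r is P(r) / D(r), with D the product of the other factors. What remains of P
    vanishes at r, and its quotient by X - r is interpolated at the other points. *)
Lemma pfnum_lagrange (rs : seq C) P : uniq rs -> (size P <= size rs)%N ->
  exists2 prs, unzip2 prs = rs & P = pfnum prs.
Proof.
elim: rs P => [|r t IH] P /=.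
  move=> _; rewrite leqn0 size_poly_eq0 => /eqP ->; by exists [::].
case/andP=> rt ut sP.
set D := \prod_(x <- t) ('X - x%:P) : {poly C}.
have sD : size D = (size t).+1 by rewrite /D size_prod_XsubC.
have Dr : D.[r] != 0.
  by rewrite -[_ == 0]/(root D r) root_prod_XsubC.
pose c := P.[r] / D.[r].
have : root (P - c *: D) r.
  by rewrite /root !hornerE divfK // subrr.
case/factor_theorem=> P1 eP1.
have [|prs u2 eP] := IH P1 ut.
  have : (size (P1 * ('X - r%:P))%R <= (size t).+1)%N.
    rewrite -eP1; apply: leq_trans (size_polyD _ _) _.
    rewrite geq_max sP size_polyN (leq_trans (size_scale_leq _ _)) //.
    by rewrite sD.
  have [->|n0] := eqVneq P1 0; first by rewrite size_poly0.
  by rewrite size_Mmonic ?monicXsubC // size_XsubC addn2.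
exists ((c, r) :: prs); first by rewrite /= u2.
rewrite /= -eP /pfden -(big_map (fun x => x.2) predT (fun x => 'X - x%:P)).
by rewrite -/(unzip2 prs) u2 -/D mulrC -eP1 addrC subrK.
Qed.

(** Isolates one pole: at [x.2] only the term with weight [x.1] survives in the numerator, which
    yields the residue. *)
Lemma pf_split prs x : x \in prs ->
  exists D S, pfden prs = ('X - x.2%:P) * D /\
              pfnum prs = x.1 *: D + ('X - x.2%:P) * S.
Proof.
elim: prs => // y t IH; rewrite inE => /predU1P[->|/IH [D [S [eD eS]]]].
  by exists (pfden t), (pfnum t); rewrite pfden_cons.
exists (('X - y.2%:P) * D), (y.1 *: D + ('X - y.2%:P) * S).
rewrite pfden_cons /= eD eS; split; first by ring.
by rewrite -!mul_polyC; ring.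
Qed.

Lemma uniq_rem (T : eqType) (s : seq T) :
  {in s, forall x, x \notin rem x s} -> uniq s.
Proof.
elim: s => // a t IH h /=.
have at_ : a \notin t by have := h a (mem_head _ _); rewrite /= eqxx.
rewrite at_ IH // => x xt; have := h x; rewrite inE xt orbT => /(_ isT) /=.
have ax : a != x by apply: contraNneq at_ => ->.
by rewrite (negPf ax) inE negb_or => /andP[].
Qed.

Lemma normr_Im_le (z : C) : `|'Im z| <= `|z|.
Proof.
rewrite normC_Re_Im -(ler_pXn2r (n := 2)) ?nnegrE ?normr_ge0 //; last first.
  by rewrite sqrtC_ge0 addr_ge0 // real_exprn_even_ge0 ?Creal_Re ?Creal_Im.
rewrite sqrtCK real_normK ?Creal_Im // lerDr.
by rewrite real_exprn_even_ge0 ?Creal_Re.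
Qed.

Lemma Im_horner_le0 (G : {poly C}) :
  (forall t : C, 0 < t -> 'Im G.[t] <= 0) -> 'Im G.[0] <= 0.
Proof.
move=> h; rewrite real_leNgt ?Creal_Im ?real0 //; apply/negP => y0.
set y := 'Im _ in y0.
have [H eH] : exists H, G = H * 'X + (G.[0])%:P.
  have : root (G - (G.[0])%:P) 0 by rewrite /root !hornerE subrr.
  by case/factor_theorem=> H; rewrite subr0 => eH; exists H; rewrite -eH subrK.
pose B := \sum_(i < size H) `|H`_i|.
have B0 : 0 <= B by apply: sumr_ge0.
have bound (t : C) : 0 < t -> t <= 1 -> `|H.[t]| <= B.
  move=> t0 t1; rewrite horner_coef (le_trans (ler_norm_sum _ _ _)) //.
  apply: ler_sum => i _; rewrite normrM ler_piMr // normrX.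
  by rewrite exprn_ile1 // ?normr_ge0 // gtr0_norm.
(* [B] bounds [H] on (0, 1], so at this t the correction t H(t) is smaller than y and the imaginary
   part of [G.[t]] stays positive. *)
pose t := y / (y + B + 1).
have d0 : 0 < y + B + 1 by rewrite ltr_wpDl // addr_ge0 // ltW.
have t0 : 0 < t by rewrite divr_gt0.
have t1 : t <= 1 by rewrite ler_pdivrMr // mul1r -addrA lerDl addr_ge0.
have := h t t0; rewrite eH hornerD hornerM hornerX hornerC raddfD /= -/y.
apply/negP; rewrite -real_ltNge ?real0 ?realD ?Creal_Im //.
have le1 : `|'Im (H.[t] * t)| <= B * t.
  apply: le_trans (normr_Im_le _) _; rewrite normrM (gtr0_norm t0).
  by rewrite ler_pM2r // bound.
have lt2 : B * t < y.
  rewrite /t mulrCA gtr_pMr // ltr_pdivrMr // mul1r -addrA addrCA.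
  by rewrite ltrDl ltr_wpDl // ltW.
have : - (B * t) <= 'Im (H.[t] * t).
  by move: le1; rewrite real_ler_norml ?Creal_Im // => /andP[].
rewrite -subr_gt0 in lt2; move=> le3.
by apply: lt_le_trans lt2 _; rewrite [y - _]addrC lerD2r.
Qed.

(* At a pole r of order n, P/Q behaves like z (s - r)^-n with z = P(r)/Q1(r);
   the sign condition then says that u^n never meets a half plane as u runs
   through the upper half plane, which is impossible for n >= 2. *)
Lemma pole_order (z : C) n : (0 < n)%N -> z != 0 ->
  (forall u, 0 <= 'Im u -> 'Im (u^* ^+ n * z) <= 0) -> n = 1%N /\ 0 < z.
Proof.
case: n => // n _ z0 h.
have n0 : n = 0%N.
  apply/eqP; case: n h => // n h; exfalso.
  (* The roots of p sum to 0, its degree being at least 2, so some root u has nonnegative imaginary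
     part. For it the expression in [h] equals i |z|^2, with positive imaginary part. *)
  pose p : {poly C} := 'X^(n.+2) - (- 'i * z)%:P.
  have sp : size p = n.+3 by rewrite size_XnsubC.
  have [rs ep] := closed_field_poly_normal p.
  have lp : lead_coef p = 1 by rewrite lead_coefXnsubC.
  rewrite lp scale1r in ep.
  have srs : size rs = n.+2 by move: sp; rewrite ep size_prod_XsubC => -[].
  have sum0 : \sum_(r <- rs) r = 0.
    have := coefPn_prod_XsubC (ps := rs); rewrite srs -ep /= => /(_ isT).
    rewrite coefB coefXn coefC /= subr0 -[n.+1 == n.+2]/(n == n.+1).
    rewrite eqn_leq ltnn andbF => /esym /eqP.
    by rewrite oppr_eq0 => /eqP.
  have [u urs Iu] : exists2 u, u \in rs & 0 <= 'Im u.
    apply/hasP; rewrite -[has _ _]negbK -all_predC; apply/negP => /allP hall.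
    have : \sum_(r <- rs) 'Im r < 0.
      case: rs srs {ep sum0} hall => // r rs _ hall; rewrite big_cons.
      rewrite -[ltRHS]addr0; apply: ltr_leD.
        have := hall r (mem_head _ _); rewrite /= -real_ltNge ?real0 ?Creal_Im //.
      rewrite big_seq; apply: sumr_le0 => x xr.
      have := hall x; rewrite inE xr orbT => /(_ isT) /=.
      by rewrite -real_ltNge ?real0 ?Creal_Im // => /ltW.
    by rewrite -raddf_sum sum0 raddf0 ltxx.
  have eu : u ^+ n.+2 = - 'i * z.
    have : root p u by rewrite ep root_prod_XsubC.
    by rewrite /root !hornerE subr_eq0 => /eqP.
  have := h u Iu; rewrite -rmorphXn eu rmorphM rmorphN /= conjCi opprK.
  rewrite -mulrA ImMil -[z^* * z]mulrC -normCK.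
  rewrite (elimT (Creal_ReP _)) ?realX ?normr_real //.
  by rewrite lt_geF // exprn_gt0 // normr_gt0.
rewrite n0; split=> //; rewrite n0 in h.
have I1 : 'Im (1 : C) = 0 by apply/Creal_ImP; rewrite real1.
have h1 := h 1; have hN := h (-1); have hi := h 'i.
rewrite expr1 rmorph1 mul1r I1 lexx in h1.
rewrite expr1 rmorphN1 mulN1r raddfN /= I1 oppr0 lexx raddfN /= oppr_le0 in hN.
rewrite expr1 conjCi mulNr raddfN /= ImMil Im_i ler01 oppr_le0 in hi.
have /Creal_ImP zr : 'Im z = 0 by apply/eqP; rewrite eq_le h1 ?hN.
by have := hi isT; rewrite (elimT (Creal_ReP _) zr) lt_def z0.
Qed.

Lemma nevanlinna_pole P Q r :
  (forall s, 0 < 'Im s -> 'Im (P.[s] * (Q.[s])^*) <= 0) ->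
  r \is Num.real -> Q != 0 -> root Q r -> ~~ root P r ->
  exists Q1, [/\ Q = Q1 * ('X - r%:P), Q1.[r] != 0 & 0 <= P.[r] / Q1.[r]].
Proof.
move=> h rr Q0 Qr Pr.
have [n [Q1]] := multiplicity_XsubC Q r; rewrite Q0 /= => Q1r eQ.
have n0 : (0 < n)%N.
  by case: n eQ => // eQ; move: Qr; rewrite eQ expr0 mulr1 (negPf Q1r).
have z0 : P.[r] * (Q1.[r])^* != 0 by rewrite mulf_neq0 // conjC_eq0.
have [|n1 z_gt0] := pole_order n0 z0.
  move=> u u0.
  (* The pole is approached along s = r + t (u + i t), where the term i t keeps s in the open half
     plane even for real u. For real t, [p2] is the conjugate of [p1], so P(s) times the conjugate
     of Q(s) is t^n G(t) for a polynomial G. *)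
  pose p1 : {poly C} := r%:P + 'X * (u%:P + 'i *: 'X).
  pose p2 : {poly C} := r%:P + 'X * ((u^*)%:P - 'i *: 'X).
  have p1E t : p1.[t] = r + t * (u + 'i * t) by rewrite /p1 !hornerE.
  have p2E t : p2.[t] = r + t * (u^* - 'i * t) by rewrite /p2 !hornerE.
  pose G := ((u^*)%:P - 'i *: 'X) ^+ n * ((P \Po p1) * (map_poly Num.conj Q1 \Po p2)).
  have GE t : G.[t] = (u^* - 'i * t) ^+ n *
      (P.[r + t * (u + 'i * t)] * (map_poly Num.conj Q1).[r + t * (u^* - 'i * t)]).
    by rewrite /G !hornerM !horner_comp p1E p2E horner_exp !hornerE.
  have G0 : G.[0] = u^* ^+ n * (P.[r] * (Q1.[r])^*).
    rewrite GE !mul0r !addr0 mulr0 subr0.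
    by rewrite -horner_map /= (CrealP rr).
  rewrite -G0; apply: Im_horner_le0 => t t0.
  pose s := r + t * (u + 'i * t).
  have tr : t \is Num.real by rewrite realE ltW.
  have Is : 0 < 'Im s.
    rewrite /s raddfD /= (elimT (Creal_ImP _) rr) add0r ImMl // raddfD /= ImMil.
    by rewrite (elimT (Creal_ReP _) tr) mulr_gt0 // ltr_wpDl.
  have := h s Is; rewrite eQ.
  have -> : P.[s] * ((Q1 * ('X - r%:P) ^+ n).[s])^* = t ^+ n * G.[t].
    have cs : r + t * (u^* - 'i * t) = s^*.
      by rewrite /s !(rmorphD, rmorphM) /= conjCi (CrealP rr) (CrealP tr) mulNr.
    rewrite GE cs horner_map /= -/s hornerM horner_exp hornerXsubC.
    rewrite !(rmorphM, rmorphXn) rmorphB /= (CrealP rr) -cs [r + _]addrC addrK.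
    by rewrite exprMn; ring.
  rewrite ImMl ?realX //.
  by rewrite pmulr_rle0 // exprn_gt0.
exists Q1; rewrite eQ n1 expr1; split=> //.
have -> : P.[r] / Q1.[r] = P.[r] * (Q1.[r])^* / `|Q1.[r]| ^+ 2.
  rewrite normCK; field; rewrite conjC_eq0 andbb; exact: Q1r.
by rewrite divr_ge0 ?exprn_ge0 // ltW.
Qed.

(** A common root of P and Q is cancelled by induction and put back as a pole of weight 0, so that
    [pfden] keeps every root of Q. With no common root, all poles are simple: the roots are
    distinct, interpolation applies, and the weights are the nonnegative residues. *)
Lemma nevanlinna_partial_fractions P Q : Q != 0 -> (size P < size Q)%N ->
  (forall r, root Q r -> r \is Num.real) ->
  (forall s, 0 < 'Im s -> 'Im (P.[s] * (Q.[s])^*) <= 0) ->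
  exists K prs, [/\ Q = K *: pfden prs, P = K *: pfnum prs &
    {in prs, forall x, 0 <= x.1 /\ x.2 \is Num.real}].
Proof.
have [n] := ubnP (size Q); elim: n P Q => // n IH P Q.
rewrite ltnS => sQ Q0 sPQ Qr h.
have [rs eQ] := closed_field_poly_normal Q.
have lQ : lead_coef Q != 0 by rewrite lead_coef_eq0.
have Qrs r : root Q r = (r \in rs) by rewrite eQ rootZ // root_prod_XsubC.
have [/hasP[r rrs Pr]|nohas] := boolP (has (root P) rs).
  have rreal : r \is Num.real by apply: Qr; rewrite Qrs.
  have /factor_theorem[P1 eP1] := Pr.
  have /factor_theorem[Q1 eQ1] : root Q r by rewrite Qrs.
  have Q10 : Q1 != 0 by apply: contra_neq Q0 => e; rewrite eQ1 e mul0r.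
  have sQ1 : size Q = (size Q1).+1.
    by rewrite eQ1 size_Mmonic ?monicXsubC // size_XsubC addn2.
  have sP1 : (size P1 < size Q1)%N.
    have [->|P10] := eqVneq P1 0; first by rewrite size_poly0 lt0n size_poly_eq0.
    move: sPQ; rewrite sQ1 ltnS eP1 size_Mmonic ?monicXsubC //.
    by rewrite size_XsubC addn2.
  have [|||K [prs [eQ2 eP2 hp]]] := IH P1 Q1 _ Q10 sP1.
  - by rewrite -ltnS -sQ1.
  - by move=> x Qx; apply: Qr; rewrite eQ1 rootM Qx.
  - move=> s Is; have := h s Is.
    have sr : s - r != 0.
      rewrite subr_eq0; apply: contraTneq Is => ->.
      by rewrite (elimT (Creal_ImP _) rreal) ltxx.
    rewrite eP1 eQ1 !hornerM rmorphM /= mulrACA hornerXsubC -normCK mulrC.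
    by rewrite ImMl ?realX ?normr_real // pmulr_rle0 // exprn_gt0 // normr_gt0.
  exists K, ((0, r) :: prs); split.
  - by rewrite pfden_cons eQ1 eQ2 scalerAr mulrC.
  - by rewrite /= scale0r add0r eP1 eP2 scalerAr mulrC.
  - by move=> x; rewrite inE => /predU1P[->|/hp].
have pole r : r \in rs -> exists Q1,
    [/\ Q = Q1 * ('X - r%:P), Q1.[r] != 0 & 0 <= P.[r] / Q1.[r]].
  move=> rrs; apply: nevanlinna_pole => //; rewrite ?Qrs //.
    by apply: Qr; rewrite Qrs.
  by apply: (hasPn nohas).
have urs : uniq rs.
  apply: uniq_rem => r rrs; have [Q1 [eQ1 Q1r _]] := pole r rrs.
  have e : Q1 = lead_coef Q *: \prod_(x <- rem r rs) ('X - x%:P).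
    apply: (mulIf (negbT (polyXsubC_eq0 r))); rewrite -eQ1 {1}eQ.
    by rewrite (perm_big _ (perm_to_rem rrs)) big_cons -scalerAl mulrC.
  apply: contra Q1r => rr; rewrite e hornerZ mulf_eq0; apply/orP; right.
  by rewrite -[_ == 0]/(root _ r) root_prod_XsubC.
have [|prs u2 eP] := pfnum_lagrange (P := (lead_coef Q)^-1 *: P) urs.
  rewrite (leq_trans (size_scale_leq _ _)) // -ltnS (leq_trans sPQ) //.
  by rewrite eQ size_scale // size_prod_XsubC.
have eD : Q = lead_coef Q *: pfden prs.
  by rewrite {1}eQ -u2 /unzip2 big_map.
exists (lead_coef Q), prs; split => //; first by rewrite -eP scalerA divff // scale1r.
move=> x xp; have xrs : x.2 \in rs by rewrite -u2 map_f.
split; last by apply: Qr; rewrite Qrs.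
have [Q1 [eQ1 Q1r]] := pole _ xrs.
have [D [S [eD1 eN1]]] := pf_split xp.
have eQ1D : Q1 = lead_coef Q *: D.
  apply: (mulIf (negbT (polyXsubC_eq0 x.2))); rewrite -eQ1 {1}eD eD1.
  by rewrite -scalerAl mulrC.
have -> : P.[x.2] = x.1 * Q1.[x.2].
  have -> : P = lead_coef Q *: pfnum prs by rewrite -eP scalerA divff // scale1r.
  rewrite eN1 eQ1D hornerZ hornerD hornerZ hornerZ hornerM hornerXsubC subrr mul0r addr0.
  by rewrite mulrCA.
by rewrite mulfK.
Qed.

End PartialFractions.

(** * Determinants under rank one updates *)

Section RankOneDeterminant.
Local Open Scope sesquilinear_scope.

(** A bordered matrix [B] has determinant [\det (M + u *m v)]. Multiplying it by a triangular matrix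
    built on [\adj M], in place of an inverse, costs a power of [\det M], which regularity
    cancels. *)
Lemma det_add_rank1_lreg (R : comNzRingType) n (M : 'M[R]_n) (u : 'cV[R]_n) (v : 'rV[R]_n) :
  GRing.lreg (\det M) ->
  \det (M + u *m v) = \det M + (v *m \adj M *m u) 0 0.
Proof.
move=> regM.
pose B := block_mx M (- u) v (1%:M : 'M[R]_1).
have e1 : \det B = \det (M + u *m v).
  have : B *m block_mx 1%:M 0 (- v) 1%:M = block_mx (M + u *m v) (- u) 0 1%:M.
    by rewrite mulmx_block !mulmx1 !mulmx0 mulmxN mulNmx opprK add0r mul1mx addrN add0r.
  move/(congr1 determinant); rewrite det_mulmx det_lblock !det1 !mulr1 => ->.
  by rewrite det_ublock det1 mulr1.
have : B *m block_mx (\adj M) (\adj M *m u) 0 (\det M)%:M =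
       block_mx (\det M)%:M 0 (v *m \adj M) (v *m \adj M *m u + (\det M)%:M).
  rewrite mulmx_block !mulmx0 !addr0 mul_mx_adj mulmxA mul_mx_adj mul1mx mulmxA.
  by rewrite mul_scalar_mx mul_mx_scalar scalerN addrN.
move/(congr1 determinant); rewrite det_mulmx det_ublock det_lblock e1.
rewrite [\det (\det M)%:M in LHS]det_scalar expr1 -det_mulmx mul_adj_mx.
rewrite !det_scalar mulrC => /(lregX (n := n) regM) ->.
by rewrite det_mx11 !mxE eqxx mulr1n addrC.
Qed.

(** The determinant of X + M is monic in X, hence regular; the general case is the regular one
    evaluated at X = 0. *)
Lemma det_add_rank1 (R : comNzRingType) n (M : 'M[R]_n) (u : 'cV[R]_n) (v : 'rV[R]_n) :
  \det (M + u *m v) = \det M + (v *m \adj M *m u) 0 0.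
Proof.
have ev p : p.[0] = horner_eval (0 : R) p by [].
pose M' := char_poly_mx (- M).
have eM : map_mx (horner_eval 0) M' = M.
  apply/matrixP => i j; rewrite !mxE /= /horner_eval hornerD hornerN hornerC opprK.
  by rewrite hornerMn hornerX mul0rn add0r.
have eC m1 m2 (A : 'M[R]_(m1, m2)) : map_mx (horner_eval 0) (map_mx polyC A) = A.
  by apply/matrixP => i j; rewrite !mxE /= /horner_eval hornerC.
have reg : GRing.lreg (\det M') by apply: monic_lreg; apply: char_poly_monic.
have := det_add_rank1_lreg (map_mx polyC u) (map_mx polyC v) reg.
move/(congr1 (horner_eval (0 : R))).
rewrite -det_map_mx map_mxD map_mxM !eC eM => ->.
rewrite rmorphD -det_map_mx eM; congr (_ + _).
rewrite -[v in RHS]eC -[u in RHS]eC -[M in RHS]eM -map_mx_adj -!map_mxM.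
by rewrite [RHS]mxE.
Qed.

End RankOneDeterminant.

(** * The determinant along a line, and its derivative *)

Section LineDeterminant.
Variables (C : fieldType) (n : nat).
Implicit Types (M A : 'M[C]_n) (s : C).

Definition detline M A : {poly C} :=
  \det (map_mx polyC M + 'X *: map_mx polyC A).

Lemma horner_detline M A s : (detline M A).[s] = \det (M + s *: A).
Proof.
rewrite -[LHS]/(horner_eval s _) -det_map_mx; congr (\det _).
by apply/matrixP => i j; rewrite !mxE /= /horner_eval !hornerE.
Qed.

Lemma detline_shift M A s : detline (M + s *: A) A = detline M A \Po ('X + s%:P).
Proof.
rewrite /detline -[RHS]/(comp_poly ('X + s%:P) _) -det_map_mx; congr (\det _).
apply/matrixP => i j; rewrite !mxE /= comp_polyD comp_polyM !comp_polyC comp_polyX.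
by rewrite polyCD polyCM; ring.
Qed.

(** Jacobi's formula, by splitting off one rank one term at a time. *)
Lemma deriv_detline_sum (l : seq ('cV[C]_n * 'rV[C]_n)) M :
  (detline M (\sum_(x <- l) x.1 *m x.2))^`().[0] =
  \sum_(x <- l) (x.2 *m \adj M *m x.1) 0 0.
Proof.
elim: l => [|x l IH].
  rewrite !big_nil /detline map_mx0 scaler0 addr0 det_map_mx derivC.
  by rewrite horner0.
rewrite !big_cons -IH /detline map_mxD scalerDr addrCA addrC map_mxM.
rewrite scalemxAl det_add_rank1.
set N := map_mx polyC M + _.
rewrite -scalemxAr mxE derivD derivM derivX mul1r hornerD addrC.
rewrite hornerD hornerM hornerX mul0r addr0; congr (_ + _).
have eN : map_mx (horner_eval 0) N = M.
  by apply/matrixP => i j; rewrite !mxE /= /horner_eval !hornerE.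
have eC m1 m2 (A : 'M[C]_(m1, m2)) : map_mx (horner_eval 0) (map_mx polyC A) = A.
  by apply/matrixP => i j; rewrite !mxE /= /horner_eval hornerC.
rewrite -[LHS]/(horner_eval 0 _).
rewrite -[x.2 in RHS]eC -[x.1 in RHS]eC -[M in RHS]eN -map_mx_adj -!map_mxM.
by rewrite [RHS]mxE.
Qed.

(** Gives the exact degree n and the top coefficient [\det A] along an invertible direction. *)
Lemma detline_char_poly M A : A \in unitmx ->
  detline M A = \det A *: char_poly (- (invmx A *m M)).
Proof.
move=> uA; rewrite -mul_polyC -det_map_mx -det_mulmx; congr (\det _).
rewrite /char_poly_mx mulmxDr mul_mx_scalar addrC; congr (_ + _).
by rewrite -map_mxN opprK -map_mxM mulKVmx.
Qed.

End LineDeterminant.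

(** * Semidefinite and definite matrices, and their splitting into rank one terms *)

Section QuadraticForms.
Local Open Scope sesquilinear_scope.
Variables (C : numClosedFieldType) (n : nat).
Implicit Types (M A B E W : 'M[C]_n) (x y : 'cV[C]_n) (s t : C).

(* In the order of C, 0 <= z means that z is real and nonnegative. *)
Definition herm M := M^t* = M.
Definition qform M x : C := (x^t* *m M *m x) 0 0.
Definition psd M := herm M /\ forall x, 0 <= qform M x.
Definition pdef M := herm M /\ forall x, x != 0 -> 0 < qform M x.
Definition imdef M := forall x, x != 0 -> 0 < 'Im (qform M x).

Lemma trmxCD m p (A B : 'M[C]_(m, p)) : (A + B)^t* = A^t* + B^t*.
Proof. by rewrite linearD /= map_mxD. Qed.

Lemma trmxCZ m p s (A : 'M[C]_(m, p)) : (s *: A)^t* = s^* *: A^t*.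
Proof. by rewrite linearZ /= map_mxZ. Qed.

Lemma trmxCM m p q (A : 'M[C]_(m, p)) (B : 'M[C]_(p, q)) :
  (A *m B)^t* = B^t* *m A^t*.
Proof. by rewrite trmx_mul map_mxM. Qed.

Lemma herm_hermsymmx M : (M \is hermsymmx) <-> herm M.
Proof.
rewrite is_hermitianmxE expr0 scale1r /herm.
by split => [/eqP e|->//]; rewrite -e.
Qed.

Lemma hermD A B : herm A -> herm B -> herm (A + B).
Proof. by rewrite /herm trmxCD => -> ->. Qed.

Lemma hermZ s A : s \is Num.real -> herm A -> herm (s *: A).
Proof. by rewrite /herm trmxCZ => /CrealP -> ->. Qed.

Lemma herm0 : herm 0.
Proof. by rewrite /herm trmx0 map_mx0. Qed.

Lemma herm1 : herm 1%:M.
Proof. by rewrite /herm trmx1 map_mx1. Qed.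

Lemma herm_sum (I : Type) (r : seq I) (P : pred I) (F : I -> 'M[C]_n) :
  (forall i, P i -> herm (F i)) -> herm (\sum_(i <- r | P i) F i).
Proof. by move=> h; elim/big_ind: _ => //; [exact: herm0 | exact: hermD]. Qed.

Lemma qformD A B x : qform (A + B) x = qform A x + qform B x.
Proof. by rewrite /qform mulmxDr mulmxDl mxE. Qed.

Lemma qformZ s A x : qform (s *: A) x = s * qform A x.
Proof. by rewrite /qform -scalemxAr -scalemxAl mxE. Qed.

Lemma qform0 x : qform 0 x = 0.
Proof. by rewrite /qform mulmx0 mul0mx mxE. Qed.

Lemma qform_sum (I : Type) (r : seq I) (P : pred I) (F : I -> 'M[C]_n) x :
  qform (\sum_(i <- r | P i) F i) x = \sum_(i <- r | P i) qform (F i) x.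
Proof.
elim: r => [|i r IH]; first by rewrite !big_nil qform0.
by rewrite !big_cons; case: (P i); rewrite ?qformD IH.
Qed.

Lemma qformC M x : (qform M x)^* = qform (M^t*) x.
Proof.
have e (z : 'M[C]_1) : (z 0 0)^* = (z^t*) 0 0 by rewrite !mxE.
by rewrite /qform e !trmxCM trmxCK mulmxA.
Qed.

Lemma herm_qform_real M x : herm M -> qform M x \is Num.real.
Proof. by move=> h; apply/CrealP; rewrite qformC h. Qed.

Lemma qform_sub_self A x t : herm A -> t \is Num.real ->
  qform A (x - t *: (A *m x)) =
  qform A x - 2 * t * qform 1%:M (A *m x) + t ^+ 2 * qform A (A *m x).
Proof.
move=> hA /CrealP tr; set y := A *m x.
have yE : y^t* = x^t* *m A by rewrite trmxCM hA.
have e : (x - t *: y)^t* *m A *m (x - t *: y) =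
    x^t* *m A *m x - (2 * t) *: (y^t* *m y) + t ^+ 2 *: (y^t* *m A *m y).
  rewrite -scaleNr trmxCD trmxCZ rmorphN /= tr yE !mulmxDl !mulmxDr.
  rewrite -!scalemxAl -!scalemxAr !mulmxA !scalerA mulrNN -expr2.
  move: (x^t* *m A *m x) (x^t* *m A *m A *m x) (x^t* *m A *m A *m A *m x) => q1 q2 q3.
  by apply/matrixP => i j; rewrite !mxE; ring.
rewrite /qform mulmx1 e.
move: (x^t* *m A *m x) (y^t* *m y) (y^t* *m A *m y) => q1 q2 q3.
by rewrite !mxE.
Qed.

Lemma qform1E x : qform 1%:M x = \sum_i `|x i 0| ^+ 2.
Proof.
by rewrite /qform mulmx1 mxE; apply: eq_bigr => i _; rewrite !mxE normCK mulrC.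
Qed.

Lemma qform1_ge0 x : 0 <= qform 1%:M x.
Proof. by rewrite qform1E; apply: sumr_ge0 => i _; rewrite exprn_ge0. Qed.

Lemma qform1_gt0 x : x != 0 -> 0 < qform 1%:M x.
Proof.
move=> x0; rewrite lt_def qform1_ge0 andbT; apply: contra x0.
rewrite qform1E psumr_eq0 => [/allP h|i _]; last by rewrite exprn_ge0.
apply/eqP/colP => i; rewrite mxE.
have := h i (mem_index_enum _); rewrite /= expf_eq0 /= normr_eq0.
by move/eqP.
Qed.

Lemma pdef1 : pdef 1%:M.
Proof. by split; [exact: herm1 | exact: qform1_gt0]. Qed.

Lemma pdef_psd M : pdef M -> psd M.
Proof.
move=> [hM pM]; split=> // x; have [->|/pM/ltW//] := eqVneq x 0.
by rewrite /qform mulmx0 mxE.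
Qed.

Lemma psd0 : psd 0.
Proof. by split; [exact: herm0 | move=> x; rewrite qform0]. Qed.

Lemma psdD A B : psd A -> psd B -> psd (A + B).
Proof.
by move=> [hA pA] [hB pB]; split=> [|x]; [exact: hermD | rewrite qformD addr_ge0].
Qed.

Lemma psdZ s A : 0 <= s -> psd A -> psd (s *: A).
Proof.
move=> s0 [hA pA]; split=> [|x]; first by apply: hermZ; rewrite ?ger0_real.
by rewrite qformZ mulr_ge0.
Qed.

Lemma psd_sum (I : Type) (r : seq I) (P : pred I) (F : I -> 'M[C]_n) :
  (forall i, P i -> psd (F i)) -> psd (\sum_(i <- r | P i) F i).
Proof. by move=> h; elim/big_ind: _ => //; [exact: psd0 | exact: psdD]. Qed.

Lemma pdefD A B : pdef A -> psd B -> pdef (A + B).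
Proof.
move=> [hA pA] [hB pB]; split=> [|x x0]; first exact: hermD.
by rewrite qformD ltr_wpDr // pA.
Qed.

Lemma pdefZ s A : 0 < s -> pdef A -> pdef (s *: A).
Proof.
move=> s0 [hA pA]; split=> [|x x0]; first by apply: hermZ; rewrite ?gtr0_real.
by rewrite qformZ mulr_gt0 // pA.
Qed.

(* Expand 0 <= <A z, z> at z = x - A x / b, and use A <= b at A x. *)
Lemma qform1_mul_le A b x : 0 < b -> psd A -> psd (b *: 1%:M - A) ->
  qform 1%:M (A *m x) <= b ^+ 2 * qform 1%:M x.
Proof.
move=> b0 [hA pA] [_ pbA].
have up y : qform A y <= b * qform 1%:M y.
  by have := pbA y; rewrite qformD -scaleN1r !qformZ mulN1r subr_ge0.
have br : b^-1 \is Num.real by rewrite realV gtr0_real.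
have := pA (x - b^-1 *: (A *m x)); rewrite qform_sub_self // => ge0.
have le1 : b^-1 ^+ 2 * qform A (A *m x) <= b^-1 * qform 1%:M (A *m x).
  by rewrite expr2 -mulrA ler_pM2l ?invr_gt0 // ler_pdivrMl // up.
rewrite expr2 -mulrA; apply: (@le_trans _ _ (b * qform A x)); last first.
  by rewrite ler_pM2l // up.
rewrite -ler_pdivrMl // -subr_ge0; apply: le_trans ge0 _; rewrite -subr_ge0.
have -> : qform A x - b^-1 * qform 1%:M (A *m x) - (qform A x -
  2 * b^-1 * qform 1%:M (A *m x) + b^-1 ^+ 2 * qform A (A *m x)) =
  b^-1 * qform 1%:M (A *m x) - b^-1 ^+ 2 * qform A (A *m x) by ring.
by rewrite subr_ge0.
Qed.

Lemma det_neq0_of_qform M : (forall x, x != 0 -> qform M x != 0) -> \det M != 0.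
Proof.
move=> h; apply/negP => /det0P [v v0 vM].
have x0 : v^t* != 0.
  apply: contra_neq v0 => e; rewrite -[v]trmxCK e.
  by apply/matrixP => i j; rewrite !mxE rmorph0.
by have := h _ x0; rewrite /qform trmxCK vM mul0mx mxE eqxx.
Qed.

Lemma imdef_det M : imdef M -> \det M != 0.
Proof.
move=> h; apply: det_neq0_of_qform => x /h; apply: contraTneq => ->.
by rewrite raddf0 ltxx.
Qed.

Lemma pdef_unitmx M : pdef M -> M \in unitmx.
Proof.
move=> [_ h]; rewrite unitmxE unitfE; apply: det_neq0_of_qform => x /h.
by apply: contraTneq => ->; rewrite ltxx.
Qed.

Lemma imdef_addZ M A s : imdef M -> psd A -> 0 <= 'Im s -> imdef (M + s *: A).
Proof.
move=> h [hA pA] s0 x x0; rewrite qformD qformZ raddfD /= ImMr ?herm_qform_real //.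
by rewrite ltr_wpDr ?h // mulr_ge0.
Qed.

Lemma imdef_line M A s : herm M -> pdef A -> 0 < 'Im s -> imdef (M + s *: A).
Proof.
move=> hM [hA pA] s0 x x0; rewrite qformD qformZ raddfD /= ImMr ?herm_qform_real //.
by rewrite (Creal_ImP _ (herm_qform_real x hM)) add0r mulr_gt0 // pA.
Qed.

Lemma det_trmxC M : \det (M^t*) = (\det M)^*.
Proof. by rewrite det_map_mx det_tr. Qed.

Definition factor A : 'M[C]_n :=
  (spectralmx A)^t* *m diag_mx (map_mx sqrtC (spectral_diag A)).

Lemma factorE A : psd A -> A = factor A *m (factor A)^t*.
Proof.
move=> [hA pA].
have hs : A \is hermsymmx by apply/herm_hermsymmx.
have /orthomx_spectralP eA := hermitian_normalmx hs.
have dreal := hermitian_spectral_diag_real hs.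
set P := spectralmx A in eA; set d := spectral_diag A in eA dreal.
have uP : P \is unitarymx := spectral_unitarymx A.
rewrite invmx_unitary // in eA.
have PP : P *m P^t* = 1%:M by apply/unitarymxP.
have d0 i : 0 <= d 0 i.
  have := pA (P^t* *m delta_mx i 0).
  rewrite /qform eA trmxCM trmxCK !mulmxA -[_ *m P *m P^t*]mulmxA PP mulmx1.
  rewrite -[_ *m P *m P^t*]mulmxA PP mulmx1 -mulmxA.
  rewrite mul_diag_mx; set X := \matrix_(_, _) _.
  have -> : (delta_mx i 0)^t* *m X = \row_j X i j.
    apply/matrixP => a b; rewrite [a]ord1 [LHS]mxE (bigD1 i) //= !mxE !eqxx /=.
    rewrite conjC1 mul1r big1 ?addr0 // => j ji.
    by rewrite !mxE (negPf ji) conjC0 mul0r.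
  by rewrite !mxE !eqxx /= mulr1.
rewrite /factor -/P -/d trmxCM trmxCK tr_diag_mx map_diag_mx.
rewrite mulmxA -[_ *m _ *m diag_mx _]mulmxA mulmx_diag {1}eA.
congr (_ *m diag_mx _ *m _); apply/rowP => i; rewrite !mxE.
rewrite -[X in _ = _ * X]/((sqrtC (d 0 i))^*) geC0_conj ?sqrtC_ge0 //.
by rewrite -expr2 sqrtCK.
Qed.

Definition colsq W (r : 'I_n) : 'M[C]_n := col r W *m (col r W)^t*.

Lemma colsq_sum W : W *m W^t* = \sum_r colsq W r.
Proof.
apply/matrixP => i j; rewrite mxE summxE; apply: eq_bigr => r _.
by rewrite /colsq [RHS]mxE big_ord_recl big_ord0 addr0 !mxE.
Qed.

Lemma herm_colsq W r : herm (colsq W r).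
Proof. by rewrite /herm /colsq trmxCM trmxCK. Qed.

End QuadraticForms.

(** * Combinations of shifted determinants and their directional derivatives *)

Section DeterminantCombinations.
Local Open Scope sesquilinear_scope.
Variables (C : numClosedFieldType) (n : nat).
Implicit Types (M A B E W : 'M[C]_n) (s t c k : C) (F G : 'M[C]_n -> C).

(* The derivative of F at M in the direction A when A is psd and F is a linear
   combination of shifted determinants, since those are affine along rank one
   matrices (see dirD_line). *)
Definition dirD A F M : C :=
  \sum_(r < n) (F (M + colsq (factor A) r) - F M).

Definition dirop c A F M : C := c * F M - dirD A F M.

Definition evalL (L : seq (C * 'M[C]_n)) M : C :=
  \sum_(x <- L) x.1 * \det (M + x.2).

(** The total weight [k] reappears in the top coefficient [k * \det A] of F along a definite line.
    Real weights and Hermitian shifts make F commute with conjugation. *)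
Definition detcomb k F := exists L : seq (C * 'M[C]_n),
  [/\ \sum_(x <- L) x.1 = k,
      {in L, forall x, x.1 \is Num.real /\ herm x.2} & F = evalL L].

Lemma detcomb_det : detcomb 1 determinant.
Proof.
exists [:: (1, 0)]; split; first by rewrite big_seq1.
  by move=> x; rewrite inE => /eqP ->; split; [exact: real1 | exact: herm0].
by apply/funext => M; rewrite /evalL big_seq1 mul1r addr0.
Qed.

Lemma detcombD k1 k2 F G : detcomb k1 F -> detcomb k2 G ->
  detcomb (k1 + k2) (fun M => F M + G M).
Proof.
move=> [L1 [<- h1 ->]] [L2 [<- h2 ->]]; exists (L1 ++ L2); split.
- by rewrite big_cat.
- by move=> x; rewrite mem_cat => /orP[/h1|/h2].
- by apply/funext => M; rewrite /evalL big_cat.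
Qed.

Lemma detcombZ c k F : c \is Num.real -> detcomb k F ->
  detcomb (c * k) (fun M => c * F M).
Proof.
move=> cr [L [<- h ->]]; exists [seq (c * x.1, x.2) | x <- L]; split.
- by rewrite big_map mulr_sumr.
- by move=> _ /mapP[x /h[h1 h2] ->]; split; rewrite ?realM.
- apply/funext => M; rewrite /evalL big_map mulr_sumr.
  by apply: eq_bigr => x _; rewrite mulrA.
Qed.

Lemma detcomb_shift k F E : herm E -> detcomb k F -> detcomb k (fun M => F (M + E)).
Proof.
move=> hE [L [<- h ->]]; exists [seq (x.1, E + x.2) | x <- L]; split.
- by rewrite big_map.
- by move=> _ /mapP[x /h[h1 h2] ->]; split=> //; apply: hermD.
- apply/funext => M; rewrite /evalL big_map.
  by apply: eq_bigr => x _; rewrite addrA.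
Qed.

Lemma detcomb0 : detcomb 0 (fun=> 0).
Proof.
exists [::]; split; rewrite ?big_nil //.
by apply/funext => M; rewrite /evalL big_nil.
Qed.

Lemma detcombB k1 k2 F G : detcomb k1 F -> detcomb k2 G ->
  detcomb (k1 - k2) (fun M => F M - G M).
Proof.
move=> hF hG; have := detcombD hF (detcombZ (c := -1) _ hG).
rewrite realN real1 mulN1r => /(_ isT).
by congr (detcomb _ _); apply/funext => M; rewrite mulN1r.
Qed.

(** Each difference has weight k - k = 0: differentiating loses the top coefficient, which makes the
    later quotients proper. *)
Lemma detcomb_dirD A k F : detcomb k F -> detcomb 0 (dirD A F).
Proof.
move=> hF.
have : detcomb (\sum_(r < n) 0)
    (fun M => \sum_(r < n) (F (M + colsq (factor A) r) - F M)).
  elim: (index_enum _) => [|r l IH].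
    rewrite big_nil; move: detcomb0; congr (detcomb _ _).
    by apply/funext => M; rewrite big_nil.
  have hr : detcomb 0 (fun M => F (M + colsq (factor A) r) - F M).
    rewrite -(subrr k); apply: detcombB => //.
    by apply: detcomb_shift => //; exact: herm_colsq.
  move: (detcombD hr IH); rewrite big_cons; congr (detcomb _ _).
  by apply/funext => M; rewrite big_cons.
by rewrite big1.
Qed.

Lemma detcomb_dirop c A k F : c \is Num.real -> detcomb k F -> detcomb (c * k) (dirop c A F).
Proof.
move=> cr hF; rewrite -[c * k]subr0; apply: detcombB; first exact: detcombZ.
exact: detcomb_dirD hF.
Qed.

Lemma dirD_comm A B F : dirD A (dirD B F) = dirD B (dirD A F).
Proof.
apply/funext => M; rewrite /dirD.
under eq_bigr do rewrite -sumrB.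
rewrite exchange_big /=; apply: eq_bigr => i _.
rewrite -sumrB; apply: eq_bigr => j _.
by rewrite -!addrA [colsq _ j + _]addrC; ring.
Qed.

Lemma dirD_dirop c A B F : dirD B (dirop c A F) = dirop c A (dirD B F).
Proof.
apply/funext => M; rewrite /dirop dirD_comm {1 3}/dirD.
rewrite mulr_sumr -sumrB; apply: eq_bigr => i _; ring.
Qed.

Lemma dirop_comm c1 c2 A B F : dirop c1 A (dirop c2 B F) = dirop c2 B (dirop c1 A F).
Proof.
apply/funext => M; rewrite {1 3}/dirop !dirD_dirop /dirop dirD_comm; ring.
Qed.

Lemma dirD_det A E M : dirD A (fun M => \det (M + E)) M =
  \sum_(r < n) ((col r (factor A))^t* *m \adj (M + E) *m col r (factor A)) 0 0.
Proof.
by apply: eq_bigr => r _; rewrite addrAC /colsq det_add_rank1 [X in X - _]addrC addrK.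
Qed.

Lemma dirD_evalL A L M : dirD A (evalL L) M =
  \sum_(x <- L) x.1 * dirD A (fun M => \det (M + x.2)) M.
Proof.
rewrite /dirD /evalL; under eq_bigr do rewrite -sumrB.
rewrite exchange_big /=; apply: eq_bigr => x _.
by rewrite [RHS]mulr_sumr; apply: eq_bigr => r _; rewrite mulrBr.
Qed.

Lemma deriv_detline A M s : psd A ->
  (detline M A)^`().[s] = dirD A (fun M => \det (M + 0)) (M + s *: A).
Proof.
move=> pA; have := congr1 (fun p => p^`().[0]) (detline_shift M A s).
rewrite deriv_comp derivD derivX derivC addr0 mulr1 horner_comp !hornerE => <-.
pose l := [seq (col r (factor A), (col r (factor A))^t*) | r <- index_enum 'I_n].
have eA : A = \sum_(x <- l) x.1 *m x.2.
  by rewrite big_map {1}(factorE pA) colsq_sum.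
by rewrite [X in detline _ X]eA deriv_detline_sum big_map dirD_det addr0.
Qed.

Lemma dirD_line k F A M : detcomb k F -> psd A -> exists q : {poly C},
  [/\ forall s, F (M + s *: A) = q.[s],
      forall s, dirD A F (M + s *: A) = q^`().[s] &
      pdef A -> (size q <= n.+1)%N /\ q`_n = k * \det A].
Proof.
move=> [L [<- hL ->]] pA.
exists (\sum_(x <- L) x.1 *: detline (M + x.2) A); split=> [s|s|dA].
- rewrite horner_sum; apply: eq_bigr => x _.
  by rewrite hornerZ horner_detline addrAC.
- rewrite dirD_evalL raddf_sum /= horner_sum; apply: eq_bigr => x _.
  rewrite derivZ hornerZ deriv_detline // !dirD_det.
  by rewrite addr0 addrAC.
have uA := pdef_unitmx dA; split.
  apply: (big_ind (fun q : {poly C} => (size q <= n.+1)%N)).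
  - by rewrite size_poly0.
  - by move=> p q hp hq; apply: leq_trans (size_polyD _ _) _; rewrite geq_max hp.
  - move=> x _; rewrite (leq_trans (size_scale_leq _ _)) // detline_char_poly //.
    by rewrite (leq_trans (size_scale_leq _ _)) // size_char_poly.
rewrite coef_sum mulr_suml; apply: eq_bigr => x _.
rewrite coefZ detline_char_poly // coefZ.
have := char_poly_monic (- (invmx A *m (M + x.2))).
by move/monicP; rewrite lead_coefE size_char_poly /= => ->; rewrite mulr1.
Qed.

(** [dirD] goes through [factor A], which is not additive in A; the trace formula shows that the
    outcome is nevertheless linear. *)
Lemma dirD_grad k F M : detcomb k F ->
  exists K, forall A, psd A -> dirD A F M = \tr (K *m A).
Proof.
move=> [L [_ _ ->]]; exists (\sum_(x <- L) x.1 *: \adj (M + x.2)) => A pA.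
rewrite dirD_evalL mulmx_suml raddf_sum /=; apply: eq_bigr => x _.
rewrite -scalemxAl mxtraceZ dirD_det [in RHS](factorE pA) colsq_sum.
rewrite mulmx_sumr raddf_sum /=; congr (_ * _); apply: eq_bigr => r _.
by rewrite /colsq mulmxA mxtrace_mulC mulmxA trace_mx11.
Qed.

Lemma dirD_det_tr A M : psd A -> dirD A determinant M = \tr (\adj M *m A).
Proof.
move=> pA; have -> : determinant = (fun M => \det (M + 0)) :> ('M[C]_n -> C).
  by apply/funext => X; rewrite addr0.
rewrite dirD_det addr0 [in RHS](factorE pA) colsq_sum.
rewrite mulmx_sumr raddf_sum /=; apply: eq_bigr => r _.
by rewrite /colsq mulmxA mxtrace_mulC mulmxA trace_mx11.
Qed.

Lemma detcomb_conj k F M : detcomb k F -> (F M)^* = F (M^t*).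
Proof.
move=> [L [_ hL ->]]; rewrite /evalL rmorph_sum big_seq [RHS]big_seq.
apply: eq_bigr => x /hL[xr hx]; rewrite rmorphM /= (CrealP xr) -det_trmxC.
by rewrite trmxCD hx.
Qed.

Lemma detcomb_real k F M : detcomb k F -> herm M -> F M \is Num.real.
Proof. by move=> hF hM; apply/CrealP; rewrite (detcomb_conj _ hF) hM. Qed.

End DeterminantCombinations.

(** * Logarithmic derivatives of polynomials without zeros in the closed upper half plane *)

Section LogDerivative.
Variable C : numClosedFieldType.

Lemma deriv_prod_XsubC (rs : seq C) K s : s \notin rs ->
  (K *: \prod_(z <- rs) ('X - z%:P))^`().[s] =
  (K *: \prod_(z <- rs) ('X - z%:P)).[s] * \sum_(z <- rs) (s - z)^-1.
Proof.
rewrite derivZ !hornerZ -mulrA => h; congr (_ * _).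
elim: rs h => [|z rs IH]; first by rewrite !big_nil derivC horner0 mulr0.
rewrite inE negb_or => /andP[sz /IH e].
have s0 : s - z != 0 by rewrite subr_eq0.
rewrite !big_cons derivM derivXsubC hornerD !hornerM hornerXsubC e hornerC.
by field.
Qed.

(** At 0, q'/q is the sum of 1 / (0 - z) over roots z in the open lower half plane, and each term
    has negative imaginary part. A real sum thus means that there are no roots at all. *)
Lemma log_deriv_Im (q : {poly C}) : (forall s, 0 <= 'Im s -> q.[s] != 0) ->
  'Im (q^`().[0] / q.[0]) <= 0 /\
  ('Im (q^`().[0] / q.[0]) = 0 -> q^`().[0] = 0).
Proof.
move=> h; have [rs eq] := closed_field_poly_normal q.
have q0 : q != 0.
  by apply/eqP => e; have := h 0; rewrite e horner0 raddf0 lexx eqxx => /(_ isT).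
have hz z : z \in rs -> 'Im z < 0.
  move=> zrs; have : q.[z] == 0.
    by rewrite -[_ == 0]/(root q z) eq rootZ ?lead_coef_eq0 // root_prod_XsubC.
  apply: contraTT; rewrite -real_leNgt ?real0 ?Creal_Im //; exact: h.
have n0 : 0 \notin rs by apply/negP => /hz; rewrite raddf0 ltxx.
have q00 : q.[0] != 0 by apply: h; rewrite raddf0.
have hI z : z \in rs -> 'Im (0 - z)^-1 < 0.
  move=> zrs; have z0 : z != 0 by apply: contraNneq n0 => <-.
  rewrite sub0r ImV raddfN /= opprK normrN pmulr_llt0 ?hz //.
  by rewrite invr_gt0 exprn_gt0 // normr_gt0.
have -> : q^`().[0] = q.[0] * \sum_(z <- rs) (0 - z)^-1.
  by rewrite eq deriv_prod_XsubC.
rewrite mulrC mulKf // raddf_sum /=.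
have le0 : \sum_(z <- rs) 'Im (0 - z)^-1 <= 0.
  by rewrite big_seq; apply: sumr_le0 => z /hI /ltW.
split=> //; case: rs hI {hz n0 eq le0} => [|z rs] hI.
  by rewrite !big_nil mulr0.
rewrite big_cons => e; exfalso; move: e; apply/eqP; rewrite lt_eqF //.
rewrite -[ltRHS]addr0 ltr_leD // ?hI ?mem_head //.
by rewrite big_seq; apply: sumr_le0 => y yr; rewrite ltW // hI // inE yr orbT.
Qed.

End LogDerivative.

(** * Stable functions, their partial fractions, and the points above their zeros *)

Section StableFunctions.
Local Open Scope sesquilinear_scope.
Variables (C : numClosedFieldType) (n : nat).
Implicit Types (M A B E W : 'M[C]_n) (s t c k : C) (F G : 'M[C]_n -> C).

Definition stable F :=
  (exists2 k, 0 < k & detcomb k F) /\ forall M, imdef M -> F M != 0.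

Lemma stable_det : stable determinant.
Proof.
split; first by exists 1; [exact: ltr01 | exact: detcomb_det].
exact: imdef_det.
Qed.

Lemma stable_log_deriv F M A : stable F -> imdef M -> psd A ->
  'Im (dirD A F M / F M) <= 0 /\
  ('Im (dirD A F M / F M) = 0 -> dirD A F M = 0).
Proof.
move=> [[k k0 hF] sF] hM pA.
have [q [qE qD _]] := dirD_line M hF pA.
have := qD 0; have := qE 0; rewrite !scale0r !addr0 => -> ->.
by apply: log_deriv_Im => s s0; rewrite -qE; apply/sF/imdef_addZ.
Qed.

(** If c F = D_A F at M, the logarithmic derivative is the real number c, so D_A F vanishes by the
    equality case of [stable_log_deriv]; then c F vanishes too, against stability. *)
Lemma stable_dirop F c A : stable F -> 0 < c -> psd A -> stable (dirop c A F).
Proof.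
move=> sF c0 pA; have [[k k0 hF] nF] := sF; split.
  by exists (c * k); [exact: mulr_gt0 | apply: detcomb_dirop; rewrite ?gtr0_real].
move=> M hM; rewrite /dirop subr_eq0; apply/eqP => e.
have FM := nF M hM.
have [_] := stable_log_deriv sF hM pA.
rewrite -e mulfK // (Creal_ImP _ (gtr0_real c0)) => /(_ erefl) /eqP.
by rewrite mulf_eq0 gt_eqF //= (negPf FM).
Qed.

Lemma pdef_det_gt0 A : pdef A -> 0 < \det A.
Proof.
move=> dA; have pA := pdef_psd dA.
have := pdef_unitmx dA; rewrite unitmxE unitfE lt_def => -> /=.
by rewrite (factorE pA) det_mulmx det_trmxC mul_conjC_ge0.
Qed.

(** Here stability meets [nevanlinna_partial_fractions]: the zeros are real by stability and
    conjugate symmetry, and D_B F / F has nonpositive imaginary part on the upper half plane. The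
    constant K is the top coefficient of F on the line. *)
Lemma stable_line F M A B : stable F -> herm M -> pdef A -> psd B ->
  exists K prs, [/\ 0 < K, {in prs, forall x, 0 <= x.1 /\ x.2 \is Num.real} &
    forall s, [/\ F (M + s *: A) = K * (pfden prs).[s],
                  dirD A F (M + s *: A) = K * (pfden prs)^`().[s],
                  dirD B F (M + s *: A) = K * (pfnum prs).[s] &
                  dirD A (dirD B F) (M + s *: A) = K * (pfnum prs)^`().[s]]].
Proof.
move=> sF hM dA pB; have [[k k0 hF] nF] := sF.
have pA := pdef_psd dA; have A0 := pdef_det_gt0 dA.
have [Q [QE QD /(_ dA)[sQ cQ]]] := dirD_line M hF pA.
have [P [PE PD /(_ dA)[sP cP]]] := dirD_line M (detcomb_dirD B hF) pA.
have lQ : Q`_n != 0 by rewrite cQ mulf_neq0 // gt_eqF.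
have Q0 : Q != 0 by apply: contra_neq lQ => ->; rewrite coef0.
have eQ : size Q = n.+1.
  apply/eqP; rewrite eqn_leq sQ ltnNge; apply: contra lQ => le.
  by rewrite nth_default.
have sPQ : (size P < size Q)%N.
  rewrite eQ ltnS; apply/leq_sizeP => j; rewrite leq_eqVlt => /predU1P[<-|lt].
    by rewrite cP mul0r.
  by rewrite nth_default // (leq_trans sP).
have him s : 0 < 'Im s -> imdef (M + s *: A) by apply: imdef_line.
have [||K [prs [eQ' eP' hprs]]] := nevanlinna_partial_fractions Q0 sPQ.
- move=> r rQ; apply/Creal_ImP/eqP; rewrite eq_le.
  rewrite !real_leNgt ?real0 ?Creal_Im //; apply/andP; split; apply/negP => Ir.
    by have := nF _ (him r Ir); rewrite QE -[_ == 0]/(root Q r) rQ.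
  have /him/nF : 0 < 'Im (r^*) by rewrite Im_conj oppr_gt0.
  have -> : M + r^* *: A = (M + r *: A)^t* by rewrite trmxCD trmxCZ hM pA.1.
  by rewrite -(detcomb_conj _ hF) conjC_eq0 QE -[_ == 0]/(root Q r) rQ.
- move=> s Is; have FM := nF _ (him s Is).
  have [le _] := stable_log_deriv sF (him s Is) pB.
  rewrite -PE -QE; move: le.
  have -> : dirD B F (M + s *: A) / F (M + s *: A) =
    `|F (M + s *: A)| ^- 2 * (dirD B F (M + s *: A) * (F (M + s *: A))^*).
    by rewrite normCK; field; rewrite conjC_eq0 andbb.
  rewrite ImMl; last by rewrite realV realX // normr_real.
  by rewrite pmulr_rle0 // invr_gt0 exprn_gt0 // normr_gt0.
have eK : K = k * \det A.
  rewrite -cQ -[n]/(n.+1.-1) -eQ -lead_coefE eQ' lead_coefZ.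
  by rewrite /pfden -(big_map (fun x => x.2) predT (fun x => 'X - x%:P))
             (monicP (monic_prod_XsubC _ _ _)) mulr1.
exists K, prs; split=> //; first by rewrite eK mulr_gt0.
by move=> s; rewrite QE QD PE PD eQ' eP' !derivZ !hornerZ.
Qed.

(** Zero is included so that [above F M] speaks of M itself; other singular matrices are left out
    because [stable_line] moves in definite directions. *)
Definition kcone B := B = 0 \/ pdef B.

Lemma kcone_psd B : kcone B -> psd B.
Proof. by case=> [->|/pdef_psd//]; exact: psd0. Qed.

Lemma kconeD A B : kcone A -> kcone B -> kcone (A + B).
Proof.
case=> [->|dA]; first by rewrite add0r.
by move/kcone_psd => pB; right; apply: pdefD.
Qed.

Lemma kconeZ s A : 0 <= s -> pdef A -> kcone (s *: A).
Proof.
rewrite le_eqVlt => /predU1P[<- _|s0 dA]; first by left; rewrite scale0r.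
by right; apply: pdefZ.
Qed.

(* The translate of the cone of positive definite matrices at M avoids the
   zeros of F, i.e. M is above the zeros of F. *)
Definition above F M := herm M /\ forall B, kcone B -> 0 < F (M + B).

Definition logderiv B F M := dirD B F M / F M.

Lemma above_gt0 F M : above F M -> 0 < F M.
Proof. by move=> [_ /(_ 0 (or_introl erefl))]; rewrite addr0. Qed.

Lemma above_add F M B : above F M -> kcone B -> above F (M + B).
Proof.
move=> [hM h] kB; split; first by apply: hermD => //; case: (kcone_psd kB).
by move=> B' kB'; rewrite -addrA h //; apply: kconeD.
Qed.

(** For phi_A = D_A F / F, the operator turns F into F (c - phi_A), whose logarithmic derivative
    along B is phi_B - D_B phi_A / (c - phi_A). As D_A and D_B commute, D_B phi_A is the derivative
    of phi_B along A, which the partial fractions give. *)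
Lemma above_line F M A B : stable F -> above F M -> pdef A -> psd B ->
  exists prs, [/\ {in prs, forall x, 0 <= x.1 /\ x.2 < 0},
    forall s, 0 <= s -> logderiv B F (M + s *: A) = \sum_(x <- prs) x.1 / (s - x.2) &
    forall c s, 0 <= s -> logderiv A F (M + s *: A) < c ->
      logderiv B (dirop c A F) (M + s *: A) = logderiv B F (M + s *: A) +
        (\sum_(x <- prs) x.1 / (s - x.2) ^+ 2) / (c - logderiv A F (M + s *: A))].
Proof.
move=> sF aM dA pB; have [hM _] := aM.
have [K [prs [K0 hp hs]]] := stable_line sF hM dA pB.
have pos s : 0 <= s -> 0 < K * (pfden prs).[s].
  by move=> s0; have [<- _ _ _] := hs s; apply/above_gt0/(above_add aM)/kconeZ.
have neg : {in prs, forall x, 0 <= x.1 /\ x.2 < 0}.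
  move=> x xp; have [x1 x2] := hp x xp; split=> //.
  rewrite real_ltNge ?real0 //; apply/negP => /pos.
  have [D [S [-> _]]] := pf_split xp.
  by rewrite hornerM hornerXsubC subrr mul0r mulr0 ltxx.
have ne s : 0 <= s -> {in prs, forall x, s != x.2}.
  by move=> s0 x /neg[_ x0]; rewrite gt_eqF // (lt_le_trans x0).
exists prs; split=> // [s s0|c s s0].
  rewrite /logderiv; have [-> _ -> _] := hs s.
  rewrite -mulf_div divff ?gt_eqF // mul1r pfnumE; last exact: ne.
  by rewrite mulrC mulKf // pfden_neq0 //; apply: ne.
have w := pfnum_wronskian (ne s s0).
rewrite /logderiv dirD_dirop /dirop; have [-> -> -> ->] := hs s.
have D0 : (pfden prs).[s] != 0 by apply/pfden_neq0/ne.
set D := (pfden prs).[s] in w D0 *; set D' := (pfden prs)^`().[s] in w *.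
set N := (pfnum prs).[s] in w *; set N' := (pfnum prs)^`().[s] in w *.
set S := \sum_(x <- prs) _ in w *.
have K0' : K != 0 by rewrite gt_eqF.
move=> lt; have ne2 : c * D - D' != 0.
  apply: contraTneq lt => /eqP; rewrite subr_eq0 => /eqP <-.
  by rewrite mulrCA mulfK ?ltxx // mulf_neq0.
have -> : S = - (N' * D - N * D') / D ^+ 2 by rewrite w opprK mulrC mulKf // expf_neq0.
have ne3 : c * (K * D) - K * D' != 0 by rewrite mulrCA -mulrBr mulf_neq0.
by field; rewrite D0 K0' ne2.
Qed.

End StableFunctions.

(** * The barrier argument for one operator *)

Section Barrier.
Local Open Scope sesquilinear_scope.
Variables (C : numClosedFieldType) (n : nat).
Implicit Types (M A B E W X : 'M[C]_n) (s t c k d : C) (F G : 'M[C]_n -> C).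

Lemma logderiv_mono F M A B : stable F -> above F M -> kcone A -> psd B ->
  logderiv B F (M + A) <= logderiv B F M.
Proof.
move=> sF aM [->|dA] pB; first by rewrite addr0.
have [prs [hp h _]] := above_line sF aM dA pB.
have := h 1 ler01; have := h 0 (lexx _); rewrite scale1r scale0r addr0 => -> ->.
rewrite big_seq [leRHS]big_seq; apply: ler_sum => x /hp[x1 x2].
rewrite ler_wpM2l // lef_pV2 ?lerD2r ?ler01 // posrE subr_gt0 //.
by rewrite (lt_trans x2) // ltr01.
Qed.

Lemma logderiv_ge0 F M B : stable F -> above F M -> psd B -> 0 <= logderiv B F M.
Proof.
move=> sF aM pB; have [prs [hp h _]] := above_line sF aM (pdef1 _ _) pB.
have := h 0 (lexx _); rewrite scale0r addr0 => ->.
rewrite big_seq; apply: sumr_ge0 => x /hp[x1 x2].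
by rewrite divr_ge0 // sub0r oppr_ge0 ltW.
Qed.

Lemma dirop_logderiv F M A c : F M != 0 -> dirop c A F M = F M * (c - logderiv A F M).
Proof. by move=> h; rewrite /dirop /logderiv mulrBr [F M * (_ / _)]mulrC divfK // mulrC. Qed.

Lemma above_dirop F M A c : stable F -> above F M -> pdef A -> logderiv A F M < c ->
  above (dirop c A F) M.
Proof.
move=> sF aM dA lt; split; first by case: aM.
move=> B kB; have aB := above_add aM kB; have g0 := above_gt0 aB.
rewrite dirop_logderiv ?gt_eqF // mulr_gt0 // subr_gt0 (le_lt_trans _ lt) //.
by apply: logderiv_mono => //; apply: pdef_psd.
Qed.

Lemma logderiv_dirop_ge F M A B c : stable F -> above F M -> pdef A -> psd B ->
  logderiv A F M < c -> logderiv B F M <= logderiv B (dirop c A F) M.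
Proof.
move=> sF aM dA pB lt; have [prs [hp _ h]] := above_line sF aM dA pB.
have := h c 0 (lexx _); rewrite scale0r addr0 => /(_ lt) ->.
rewrite lerDl divr_ge0 ?subr_ge0 ?(ltW lt) // big_seq; apply: sumr_ge0 => x /hp[x1 x2].
by rewrite divr_ge0 // exprn_ge0 // sub0r oppr_ge0 ltW.
Qed.

(** Moving by d A compensates what the operator adds: the factor 1 / (c - phi_A) is at most d, and
    term by term 1/(d + y) + d/(d + y)^2 <= 1/y by convexity, where -y is the pole. *)
Lemma barrier_step F M A c d : stable F -> above F M -> pdef A -> 0 < d ->
  logderiv A F M <= c - d^-1 ->
  above (dirop c A F) (M + d *: A) /\
  forall B, psd B -> logderiv B (dirop c A F) (M + d *: A) <= logderiv B F M.
Proof.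
move=> sF aM dA d0 le; have kA : kcone (d *: A) by apply: kconeZ => //; exact: ltW.
have le' : logderiv A F (M + d *: A) <= c - d^-1.
  by apply: le_trans le; apply: logderiv_mono => //; exact: pdef_psd.
have lt : logderiv A F (M + d *: A) < c.
  by apply: le_lt_trans le' _; rewrite gtrDl oppr_lt0 invr_gt0.
split; first by apply: above_dirop => //; exact: above_add.
move=> B pB; have [prs [hp h h']] := above_line sF aM dA pB.
rewrite (h' _ _ (ltW d0) lt); have := h 0 (lexx _); rewrite scale0r addr0 => ->.
rewrite (h _ (ltW d0)).
set S := \sum_(x <- prs) _ / _ ^+ 2.
have S0 : 0 <= S.
  rewrite /S big_seq; apply: sumr_ge0 => x /hp[x1 x2].
  by rewrite divr_ge0 // exprn_ge0 // subr_ge0 ltW // (lt_trans x2).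
have {}le' : d^-1 <= c - logderiv A F (M + d *: A) by rewrite lerBrDl -lerBrDr.
have : S / (c - logderiv A F (M + d *: A)) <= S * d.
  rewrite ler_wpM2l // -[leRHS]invrK lef_pV2 // posrE ?invr_gt0 //.
  by rewrite subr_gt0.
rewrite -(lerD2l (\sum_(x <- prs) x.1 / (d - x.2))) => le2.
apply: (le_trans le2).
rewrite /S mulr_suml -big_split /= big_seq [leRHS]big_seq.
apply: ler_sum => x /hp[x1 x2]; rewrite -mulrA -mulrDr ler_wpM2l // sub0r.
have x0 : 0 < - x.2 by rewrite oppr_gt0.
set y := - x.2 in x0 *; have yd : 0 < d + y by rewrite addr_gt0.
rewrite -subr_ge0.
have -> : y^-1 - ((d + y)^-1 + ((d + y) ^+ 2)^-1 * d) = d ^+ 2 / (y * (d + y) ^+ 2).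
  by field; rewrite !gt_eqF.
by rewrite divr_ge0 ?mulr_ge0 ?exprn_ge0 // ltW.
Qed.

(* Along the line M + B + s 1, at the largest zero of F with s >= 0 one would
   have dirop c A F = - dirD A F <= 0. *)
Lemma above_of_dirop F M A c : stable F -> pdef A -> above (dirop c A F) M -> above F M.
Proof.
move=> sF dA [hM h]; split=> // B kB.
have hMB : herm (M + B) by apply: hermD => //; case: (kcone_psd kB).
have [K [prs [K0 hp hs]]] := stable_line sF hMB (pdef1 _ _) (pdef_psd dA).
have opE s : 0 <= s -> 0 < c * (K * (pfden prs).[s]) - K * (pfnum prs).[s].
  move=> s0; have [<- _ <- _] := hs s.
  by rewrite -addrA; apply/h/kconeD => //; apply: kconeZ => //; exact: pdef1.
have [FE _ _ _] := hs 0; rewrite scale0r addr0 in FE.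
have top_zero : exists2 s, s \is Num.real & {in prs, forall x, x.2 <= s} /\
    (s < 0 \/ 0 <= s /\ (pfden prs).[s] = 0).
  elim: prs {hs opE FE} hp => [|x t IH] hp.
    by exists (-1); rewrite ?realN ?real1 //; split=> //; left; rewrite oppr_lt0 ltr01.
  have [|s sr [hs1 hs2]] := IH; first by move=> y yt; apply: hp; rewrite inE yt orbT.
  have [_ xr] := hp x (mem_head _ _).
  case: (real_leP xr sr) => [le|lt].
    exists s => //; split; first by move=> y; rewrite inE => /predU1P[->|/hs1].
    case: hs2 => [|[s0 e]]; [by left | right; split => //].
    by rewrite pfden_cons hornerM e mulr0.
  exists x.2 => //; split.
    by move=> y; rewrite inE => /predU1P[->//|/hs1 /le_trans->//]; exact: ltW.
  case: (real_ltP xr (real0 C)) => [|x0]; [by left | right; split=> //].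
  by rewrite pfden_cons hornerM hornerXsubC subrr mul0r.
case: top_zero => s sr [hs1 [s0|[s0 e]]]; last first.
  have := opE s s0; rewrite e mulr0 mulr0 sub0r oppr_gt0 pmulr_rlt0 // => lt0.
  by have := lt_le_trans lt0 (pfnum_ge0 (fun x xp => (hp x xp).1) hs1); rewrite ltxx.
rewrite FE mulr_gt0 // /pfden horner_prod big_seq prodr_gt0 // => x xp.
by rewrite hornerXsubC sub0r oppr_gt0 (le_lt_trans (hs1 _ xp)).
Qed.

(** Along X the logarithmic derivative at 0 is the sum of 1 / (-z) over zeros z < 0. The sum is
    below c, hence so is each term, and every zero lies below -1/c. *)
Lemma above_shift F M X c : stable F -> above F M -> pdef X -> 0 < c ->
  logderiv X F M < c -> above F (M - c^-1 *: X).
Proof.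
move=> sF aM dX c0 lt; have [hM _] := aM; have [hX _] := dX.
split.
  apply: hermD => //; rewrite -scaleNr; apply: hermZ => //.
  by rewrite realN realV gtr0_real.
move=> B kB; have aB := above_add aM kB; have [hMB _] := aB.
have {}lt : logderiv X F (M + B) < c.
  by apply: le_lt_trans lt; apply: logderiv_mono => //; exact: pdef_psd.
have [K [prs [K0 hp hs]]] := stable_line sF hMB dX (pdef_psd dX).
have pos s : 0 <= s -> 0 < K * (pfden prs).[s].
  by move=> s0; have [<- _ _ _] := hs s; apply/above_gt0/(above_add aB)/kconeZ.
have neg : {in prs, forall x, x.2 < 0}.
  move=> x xp; have [_ x2] := hp x xp.
  rewrite real_ltNge ?real0 //; apply/negP => /pos.
  have [D [S [-> _]]] := pf_split xp.
  by rewrite hornerM hornerXsubC subrr mul0r mulr0 ltxx.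
have -> : M - c^-1 *: X + B = M + B + (- c^-1) *: X by rewrite scaleNr addrAC.
have [-> _ _ _] := hs (- c^-1).
move: lt; rewrite /logderiv; have := hs 0; rewrite scale0r addr0 => -[-> -> _ _].
have D0 : (pfden prs).[0] != 0.
  by apply: pfden_neq0 => x /neg; rewrite eq_sym => /lt_eqF ->.
rewrite -mulf_div divff ?gt_eqF // mul1r.
pose rs := unzip2 prs.
have eD : pfden prs = 1 *: \prod_(z <- rs) ('X - z%:P).
  by rewrite scale1r /rs /unzip2 big_map.
have n0 : 0 \notin rs by apply/negP => /mapP[x /neg]; move=> h e; rewrite -e ltxx in h.
rewrite {1}eD deriv_prod_XsubC // -eD mulrC mulKf // => lt.
rewrite mulr_gt0 // eD hornerZ mul1r horner_prod big_seq prodr_gt0 // => z zrs.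
have z0 : z < 0 by case/mapP: zrs => x /neg h ->.
have h : (0 - z)^-1 < c.
  apply: le_lt_trans lt; rewrite (big_rem z) //= lerDl big_seq.
  apply: sumr_ge0 => y /mem_rem /mapP[x /neg x0 ->].
  by rewrite sub0r invr_ge0 oppr_ge0 ltW.
rewrite sub0r in h; rewrite hornerXsubC addrC subr_gt0 -[ltRHS]invrK.
by rewrite ltf_pV2 // posrE ?invr_gt0 oppr_gt0.
Qed.

End Barrier.

(** * Products of operators: barrier, selection of values, and peeling *)

Section IteratedOperators.
Local Open Scope sesquilinear_scope.
Variables (C : numClosedFieldType) (n : nat).
Implicit Types (M A B E U V X : 'M[C]_n) (k d : C) (F G : 'M[C]_n -> C).
Implicit Types (L : seq (C * 'M[C]_n)).

Definition diropseq L := foldr (fun x F => dirop x.1 x.2 F) determinant L.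

Definition posdirops L := {in L, forall x, 0 < x.1 /\ pdef x.2}.

Lemma posdirops_cons x L : posdirops (x :: L) -> (0 < x.1 /\ pdef x.2) /\ posdirops L.
Proof.
move=> h; split; first by apply: h; rewrite mem_head.
by move=> y yL; apply: h; rewrite inE yL orbT.
Qed.

Lemma stable_diropseq L : posdirops L -> stable (diropseq L).
Proof.
elim: L => [|x L IH] h /=; first exact: stable_det.
have [[x1 x2] /IH sL] := posdirops_cons h.
by apply: stable_dirop => //; exact: pdef_psd.
Qed.

Lemma diropseq_mid L1 x L2 : diropseq (L1 ++ x :: L2) = dirop x.1 x.2 (diropseq (L1 ++ L2)).
Proof. by elim: L1 => //= y L1 ->; rewrite dirop_comm. Qed.

Lemma dirD_psdD F M A B : stable F -> psd A -> psd B ->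
  dirD (A + B) F M = dirD A F M + dirD B F M.
Proof.
move=> [[k _ hF] _] pA pB; have [K hK] := dirD_grad M hF.
by rewrite !hK ?mulmxDr ?mxtraceD //; exact: psdD.
Qed.

Lemma dirD_psd_sum (S : finType) F M (p : S -> C) (A : S -> 'M[C]_n) :
  stable F -> (forall s, 0 <= p s) -> (forall s, psd (A s)) ->
  dirD (\sum_s p s *: A s) F M = \sum_s p s * dirD (A s) F M.
Proof.
move=> [[k _ hF] _] p0 pA; have [K hK] := dirD_grad M hF.
rewrite hK; last by apply: psd_sum => s _; apply: psdZ.
rewrite mulmx_sumr raddf_sum /=; apply: eq_bigr => s _.
by rewrite -scalemxAr mxtraceZ hK.
Qed.

Lemma above_det M : pdef M -> above determinant M.
Proof.
move=> dM; split; first by case: dM.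
by move=> B /kcone_psd pB; apply/pdef_det_gt0/pdefD.
Qed.

Lemma barrier_iter M d L : posdirops L -> above determinant M -> 0 < d ->
  {in L, forall x, logderiv x.2 determinant M <= x.1 - d^-1} ->
  above (diropseq L) (M + d *: \sum_(x <- L) x.2) /\
  forall B, psd B ->
    logderiv B (diropseq L) (M + d *: \sum_(x <- L) x.2) <= logderiv B determinant M.
Proof.
elim: L => [|x L IH] hL aM d0 h.
  by rewrite big_nil scaler0 addr0; split.
have [[x1 x2] hL'] := posdirops_cons hL.
have [|aL pL] := IH hL' aM d0.
  by move=> y yL; apply: h; rewrite inE yL orbT.
have sL := stable_diropseq hL'.
have le : logderiv x.2 (diropseq L) (M + d *: \sum_(y <- L) y.2) <= x.1 - d^-1.
  by apply: le_trans (pL _ (pdef_psd x2)) _; apply: h; rewrite mem_head.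
have [aS pS] := barrier_step sL aL x2 d0 le.
rewrite big_cons scalerDr [d *: x.2 + _]addrC addrA; split=> // B pB.
by apply: le_trans (pS B pB) (pL B pB).
Qed.

(** The value at M is an average over s, so it is positive for some s with p s > 0. As F M > 0, this
    says that the logarithmic derivative along A s is below c s, and by monotonicity that is enough
    for the whole cone. *)
Lemma select_one (S : finType) F M (p c : S -> C) (A : S -> 'M[C]_n) :
  stable F -> (forall s, 0 <= p s) -> (forall s, pdef (A s)) ->
  (forall s, c s \is Num.real) ->
  pdef (\sum_s p s *: A s) ->
  above (dirop (\sum_s p s * c s) (\sum_s p s *: A s) F) M ->
  exists2 s, 0 < p s & above (dirop (c s) (A s) F) M.
Proof.
move=> sF p0 dA cr dbar ab; have aF := above_of_dirop sF dbar ab.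
have hM : herm M by case: aF.
have F0 := above_gt0 aF.
have [[k _ hF] _] := sF.
have opr s : dirop (c s) (A s) F M \is Num.real.
  rewrite /dirop realB ?realM ?cr ?(detcomb_real hF) //.
  exact: detcomb_real (detcomb_dirD _ hF) hM.
have := above_gt0 ab; rewrite {1}/dirop dirD_psd_sum //; last by move=> s; exact: pdef_psd.
rewrite mulr_suml -sumrB => pos.
have [s ps os] : exists2 s, 0 < p s & 0 < dirop (c s) (A s) F M.
  have [/existsP[s /andP[]]|/existsPn h] :=
    boolP [exists s, (0 < p s) && (0 < dirop (c s) (A s) F M)]; first by exists s.
  suff : \sum_s (p s * c s * F M - p s * dirD (A s) F M) <= 0.
    by move/(lt_le_trans pos); rewrite ltxx.
  apply: sumr_le0 => s _; rewrite -mulrA -mulrBr.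
  have := p0 s; rewrite le_eqVlt => /predU1P[<-|ps]; first by rewrite mul0r.
  rewrite pmulr_rle0 //; have := h s; rewrite ps /=.
  by rewrite -real_leNgt ?real0.
exists s; first exact: ps.
apply: above_dirop => //.
by move: os; rewrite dirop_logderiv ?gt_eqF // (pmulr_rgt0 _ F0) subr_gt0.
Qed.

(** [L] collects the operators already fixed; since operators commute, the next average can be
    treated as the outermost one. *)
Lemma select_all (I : eqType) (S : finType) (p c : I -> S -> C)
    (A : I -> S -> 'M[C]_n) M (js : seq I) L :
  uniq js -> posdirops L -> (forall i s, 0 <= p i s) -> (forall i s, pdef (A i s)) ->
  (forall i s, 0 < c i s) ->
  (forall i, 0 < \sum_s p i s * c i s) ->
  (forall i, pdef (\sum_s p i s *: A i s)) ->
  above (diropseq (L ++ [seq (\sum_s p i s * c i s, \sum_s p i s *: A i s) | i <- js])) M ->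
  exists sel : I -> S, {in js, forall i, 0 < p i (sel i)} /\
    above (diropseq (L ++ [seq (c i (sel i), A i (sel i)) | i <- js])) M.
Proof.
move=> ujs hL p0 dA c0 cb Ab; elim: js ujs L hL => [|i js IH] /=.
  move=> _ L hL ab.
  (* With nothing left to select, a function is still owed; S is inhabited because the averages [cb]
     are nonzero. *)
  have s0 : I -> S.
    move=> i; have : exists s, p i s * c i s != 0.
      have [/existsP//|/existsPn h] := boolP [exists s, p i s * c i s != 0].
      have := cb i; rewrite big1 ?ltxx // => s _.
      by apply/eqP; move: (h s); rewrite negbK.
    by move/cid => [s _]; exact: s.
  by exists s0.
move=> /andP[ijs ujs] L hL; rewrite diropseq_mid /= => ab.
have sF : stable (diropseq
    (L ++ [seq (\sum_s p i s * c i s, \sum_s p i s *: A i s) | i <- js])).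
  apply: stable_diropseq => x; rewrite mem_cat => /orP[/hL//|/mapP[j _ ->]].
  by split; [exact: cb | exact: Ab].
have [|s ps as_] := select_one sF (p0 i) (dA i) _ (Ab i) ab.
  by move=> s; rewrite gtr0_real.
have hL' : posdirops (rcons L (c i s, A i s)).
  move=> x; rewrite mem_rcons inE => /predU1P[->|/hL//].
  by split; [exact: c0 | exact: dA].
have [|sel [selp sela]] := IH ujs _ hL'.
  by rewrite cat_rcons diropseq_mid.
exists (fun j => if j == i then s else sel j); split.
  move=> j; rewrite inE; case: eqP => [->//|_] /=; exact: selp.
rewrite eqxx; rewrite cat_rcons in sela; move: sela.
congr (above (diropseq (_ ++ _ :: _)) _); apply/eq_in_map => j jjs.
by case: eqP => // e; rewrite -e jjs in ijs.
Qed.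

(** Every operator raises the potential, so the explicit potential of the determinant is a lower
    bound; [peel_dirops] uses it for the share taken by V. *)
Lemma logderiv_diropseq_ge L M B : posdirops L -> psd B -> above (diropseq L) M ->
  above determinant M /\ logderiv B determinant M <= logderiv B (diropseq L) M.
Proof.
move=> hL pB; elim: L hL => [|x L IH] hL //= ab.
have [[x1 x2] hL'] := posdirops_cons hL; have sL := stable_diropseq hL'.
have aL := above_of_dirop sL x2 ab; have [aM le] := IH hL' aL.
split=> //; apply: le_trans le _; apply: logderiv_dirop_ge => //.
have := above_gt0 ab; have g0 := above_gt0 aL.
by rewrite dirop_logderiv ?gt_eqF // pmulr_rgt0 // subr_gt0.
Qed.

Lemma logderiv_det_eigen M V (x : C) : x != 0 -> psd V -> \det M != 0 -> M *m V = x *: V ->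
  logderiv V determinant M = \tr V / x.
Proof.
move=> x0 pV M0 e; rewrite /logderiv dirD_det_tr //.
have : \adj M *m (M *m V) = \det M *: V.
  by rewrite mulmxA mul_adj_mx mul_scalar_mx.
rewrite e -scalemxAr => /(congr1 mxtrace); rewrite !mxtraceZ => {}e.
by apply: (mulfI x0); rewrite mulrA e; field; rewrite x0 M0.
Qed.

(* In block j (the part U of X = U + V) each step moves the barrier by U / c0,
   because the other blocks already use up tr V / x of the potential. *)
Lemma peel_dirops (J : Type) (r : seq J) (c : J -> C) (U V : J -> 'M[C]_n) M c0 (x : C) :
  0 < x -> 0 < c0 -> (forall j, 0 < c j) ->
  (forall j, psd (U j)) -> (forall j, psd (V j)) -> (forall j, pdef (U j + V j)) ->
  (forall i j, U i *m V j = 0) ->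
  (forall j, M *m V j = x *: V j) ->
  foldr (fun j b => c j - \tr (V j) / x <= c0 /\ b) True r ->
  above (diropseq [seq (c j, U j + V j) | j <- r]) M ->
  above determinant (M - c0^-1 *: \sum_(j <- r) U j).
Proof.
move=> x0 c00 cp pU pV dX UV; elim: r M => [|j r IH] M MV /=.
  by move=> _; rewrite big_nil scaler0 subr0.
move=> [cj hr] ab.
have hL : posdirops [seq (c j, U j + V j) | j <- r].
  elim: (r) => // i r' h y; rewrite inE => /predU1P[->|/h//].
  by split; [exact: cp | exact: dX].
have sL := stable_diropseq hL; set F := diropseq _ in sL ab.
have aF := above_of_dirop sL (dX j) ab; have F0 := above_gt0 aF.
have lt : logderiv (U j + V j) F M < c j.
  by have := above_gt0 ab; rewrite dirop_logderiv ?gt_eqF // pmulr_rgt0 // subr_gt0.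
have [aM leV] := logderiv_diropseq_ge hL (pV j) aF.
rewrite (logderiv_det_eigen _ (pV j) _ (MV j)) ?gt_eqF // ?above_gt0 // in leV.
have ltU : logderiv (U j) F M < c0.
  apply: lt_le_trans cj; rewrite ltrBrDr; apply: le_lt_trans lt.
  by rewrite {2}/logderiv dirD_psdD // mulrDl lerD2l.
(* U j may be singular while [above_shift] asks for a definite direction, so U j + e 1 is used, with
   e small enough to stay below c0. The surplus is given back in [aU]. *)
pose e := (c0 - logderiv (U j) F M) / (logderiv 1%:M F M + 1).
have p1 : psd (1%:M : 'M[C]_n) by apply/pdef_psd/pdef1.
have ph1 : 0 <= logderiv 1%:M F M by apply: logderiv_ge0.
have den : 0 < logderiv 1%:M F M + 1 by rewrite ltr_wpDl.
have e0 : 0 < e by rewrite divr_gt0 // subr_gt0.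
have pe : psd (e *: 1%:M : 'M[C]_n) by apply: psdZ => //; exact: ltW.
have dUe : pdef (U j + e *: 1%:M).
  by rewrite addrC; apply: pdefD => //; apply: pdefZ => //; exact: pdef1.
have lt2 : logderiv (U j + e *: 1%:M) F M < c0.
  rewrite /logderiv dirD_psdD //.
  have -> : dirD (e *: 1%:M) F M = e * dirD 1%:M F M.
    have [[k _ hF] _] := sL; have [K hK] := dirD_grad M hF.
    by rewrite !hK // -scalemxAr mxtraceZ.
  rewrite mulrDl -mulrA -!/(logderiv _ _ _) -ltrBrDl /e -mulrA.
  rewrite gtr_pMr ?subr_gt0 // mulrC ltr_pdivrMr // mul1r ltrDl ltr01 //.
have aU : above F (M - c0^-1 *: U j).
  have := above_add (above_shift sL aF dUe c00 lt2)
     (B := (c0^-1 * e) *: 1%:M) (or_intror (pdefZ _ (pdef1 _ _))).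
  rewrite mulr_gt0 ?invr_gt0 // => /(_ isT).
  by congr (above _ _); rewrite scalerDr scalerA opprD addrA subrK.
(* The shifted matrix still acts on V as x, because U and V are orthogonal. *)
rewrite big_cons scalerDr opprD addrA; apply: IH => // i.
by rewrite mulmxBl MV -scalemxAl UV scaler0 subr0.
Qed.

(** A negative eigenvalue l would make M - l 1 singular, although -l 1 lies in the cone. *)
Lemma psd_of_above M : above determinant M -> psd M.
Proof.
move=> [hM h]; split=> // x.
have hs : M \is hermsymmx by apply/herm_hermsymmx.
have /orthomx_spectralP eM := hermitian_normalmx hs.
have dreal := hermitian_spectral_diag_real hs.
set P := spectralmx M in eM; set d := spectral_diag M in eM dreal.
have uP : P \is unitarymx := spectral_unitarymx M.
have uP' := unitarymx_unit uP.
have d0 i : 0 <= d 0 i.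
  have dr : d 0 i \is Num.real by apply/mxOverP.
  rewrite real_leNgt ?real0 //; apply/negP => di.
  have kc : kcone ((- d 0 i) *: 1%:M : 'M[C]_n).
    by right; apply: pdefZ; [rewrite oppr_gt0 | exact: pdef1].
  have := h _ kc; suff -> : \det (M + (- d 0 i) *: 1%:M) = 0 by rewrite ltxx.
  apply/eqP/det0P; exists (row i P).
    apply/eqP => e0; have := congr1 (fun A => row i A) (mulmxV uP').
    rewrite row_mul e0 mul0mx row1 => /rowP /(_ i); rewrite !mxE !eqxx.
    by move/esym/eqP; rewrite oner_eq0.
  have e : P *m M = diag_mx d *m P by rewrite {1}eM !mulmxA mulmxV // mul1mx.
  rewrite mulmxDr -row_mul e -scalemxAr mulmx1 row_mul row_diag_mx -scalemxAl.
  by rewrite -rowE scaleNr addrN.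
rewrite eM invmx_unitary // /qform.
have -> : x^t* *m (P^t* *m diag_mx d *m P) *m x = (P *m x)^t* *m (diag_mx d *m (P *m x)).
  by rewrite trmxCM !mulmxA.
rewrite mxE; apply: sumr_ge0 => i _; rewrite mul_diag_mx.
rewrite mxE [X in _ * X]mxE [X in Num.conj X]mxE mulrCA mulr_ge0 //.
by rewrite mulrC -normCK exprn_ge0.
Qed.

End IteratedOperators.

(** * Selection of values in the definite case *)

Section BlockSelection.
Local Open Scope sesquilinear_scope.
Variables (C : numClosedFieldType) (n : nat).

Lemma psd_conj (E M : 'M[C]_n) : herm E -> psd M -> psd (E *m M *m E).
Proof.
move=> hE [hM pM]; split; first by rewrite /herm !trmxCM hE hM mulmxA.
move=> x; have -> : qform (E *m M *m E) x = qform M (E *m x).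
  by rewrite /qform trmxCM hE !mulmxA.
exact: pM.
Qed.

Lemma psd_tr_ge0 (M : 'M[C]_n) : psd M -> 0 <= \tr M.
Proof.
move=> pM; rewrite (factorE pM) colsq_sum raddf_sum /=; apply: sumr_ge0 => r _.
rewrite /colsq mxtrace_mulC trace_mx11.
have := qform1_ge0 (col r (factor M)); by rewrite /qform mulmx1.
Qed.

Lemma weighted_sum_gt0 (S : finType) (p c : S -> C) :
  (forall s, 0 <= p s) -> \sum_s p s = 1 -> (forall s, 0 < c s) ->
  0 < \sum_s p s * c s.
Proof.
move=> p0 p1 c0; have pc s : 0 <= p s * c s by rewrite mulr_ge0 // ltW.
rewrite lt_def sumr_ge0 // andbT psumr_eq0 //; apply/negP => /allP h.
have := oner_neq0 C; rewrite -p1 big1 ?eqxx // => s _.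
by have := h s (mem_index_enum _); rewrite mulf_eq0 (gt_eqF (c0 s)) orbF => /eqP.
Qed.

Lemma pdef_sum_pos (S : finType) (p : S -> C) (A : S -> 'M[C]_n) :
  (forall s, 0 <= p s) -> \sum_s p s = 1 -> (forall s, pdef (A s)) ->
  pdef (\sum_s p s *: A s).
Proof.
move=> p0 p1 dA; split.
  by apply: herm_sum => s _; apply: hermZ; [exact: ger0_real | case: (dA s)].
move=> x x0; rewrite qform_sum; under eq_bigr do rewrite qformZ.
by apply: weighted_sum_gt0 => // s; case: (dA s) => _; apply.
Qed.

Variables (m k : nat) (S : finType).
Variables (E : 'I_k -> 'M[C]_n) (p : 'I_m -> S -> C) (Z : 'I_m -> S -> 'M[C]_n) (eps : C).

Hypothesis E_herm : forall j, herm (E j).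
Hypothesis E_idem : forall j, E j *m E j = E j.
Hypothesis E_sum : \sum_j E j = 1%:M.
Hypothesis E_comm : forall i s j, E j *m Z i s = Z i s *m E j.
Hypothesis p_ge0 : forall i s, 0 <= p i s.
Hypothesis p_sum : forall i, \sum_s p i s = 1.
Hypothesis eps_gt0 : 0 < eps.
Hypothesis tr_le : forall i s j, 0 < p i s -> \tr (E j *m Z i s) <= eps.

Lemma psd_block i s j : psd (Z i s) -> psd (E j *m Z i s).
Proof.
move=> pZ; rewrite -{1}(E_idem j) -mulmxA E_comm mulmxA.
exact: psd_conj.
Qed.

Lemma psd_coblock i s j : psd (Z i s) -> psd (Z i s - E j *m Z i s).
Proof.
move=> pZ; have hE : herm (1%:M - E j).
  apply: hermD; first exact: herm1.
  by rewrite -scaleN1r; apply: hermZ; rewrite ?realN ?real1.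
have := psd_conj hE pZ; congr psd.
rewrite mulmxBr mulmx1 mulmxBl mul1mx mulmxBl -E_comm.
by rewrite -mulmxA -E_comm mulmxA E_idem subrr subr0.
Qed.

Lemma bound_of_blocks (Y : 'M[C]_n) (b : C) :
  (forall j, E j *m Y = Y *m E j) ->
  (forall j, psd (b *: 1%:M - E j *m Y)) -> psd (b *: 1%:M - Y).
Proof.
move=> EY h; have -> : b *: 1%:M - Y = \sum_j E j *m (b *: 1%:M - E j *m Y) *m E j.
  transitivity (\sum_j E j *m (b *: 1%:M - Y)).
    by rewrite -mulmx_suml E_sum mul1mx.
  apply: eq_bigr => j _; rewrite !mulmxBr mulmxBl -!scalemxAr !mulmx1 -scalemxAl.
  by rewrite E_idem mulmxA E_idem -mulmxA -EY mulmxA E_idem.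
by apply: psd_sum => j _; apply: psd_conj.
Qed.

Theorem block_selection_strict : (0 < k)%N ->
  (forall i s, pdef (Z i s)) ->
  pdef (1%:M - \sum_i \sum_s p i s *: Z i s) ->
  exists sel : 'I_m -> S, (forall i, 0 < p i (sel i)) /\
    psd ((1 + 2 * sqrtC (eps * k%:R) + eps) *: 1%:M - \sum_i Z i (sel i)).
Proof.
move=> k0 dZ dsum.
have pZ i s := pdef_psd (dZ i s).
set kap := eps * k%:R; have kap0 : 0 < kap by rewrite mulr_gt0 // ltr0n.
set r := sqrtC kap; have r0 : 0 < r by rewrite sqrtC_gt0.
have er : kap = r ^+ 2 by rewrite sqrtCK.
(* Starting at t 1 with steps d, a summand of trace kap needs kap / t + 1 / d <= 1. These t and d
   give equality and minimise t + d, whose value is x. *)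
pose x := (1 + r) ^+ 2; pose t := r * (1 + r); pose d := 1 + r.
have d0 : 0 < d by rewrite addr_gt0 // ltr01.
have t0 : 0 < t by rewrite mulr_gt0.
have x0 : 0 < x by rewrite exprn_gt0.
have xtd : x = t + d by rewrite /x /t /d; ring.
have r1 : 1 + r != 0 by rewrite gt_eqF.
pose c i s := 1 - (kap - \tr (Z i s)) / x.
pose Zb i := \sum_s p i s *: Z i s.
have dZb i : pdef (Zb i) by apply: pdef_sum_pos.
have trZ i s : \tr (Z i s) = \sum_j \tr (E j *m Z i s).
  by rewrite -raddf_sum -mulmx_suml E_sum mul1mx.
have trZ_le i s : 0 < p i s -> \tr (Z i s) <= kap.
  move=> ps; rewrite trZ.
  apply: le_trans (ler_sum _ (fun j _ => tr_le j ps)) _.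
  by rewrite sumr_const card_ord -mulr_natr.
have c0 i s : 0 < c i s.
  rewrite /c subr_gt0 ltr_pdivrMr // mul1r.
  apply: le_lt_trans (_ : kap < x); first by rewrite lerBlDr lerDl psd_tr_ge0.
  have -> : x = kap + (1 + 2 * r) by rewrite /x er; ring.
  by rewrite ltrDl addr_gt0 ?ltr01 // mulr_gt0 // ltr0n.
have cbE i : \sum_s p i s * c i s = 1 - (kap - \tr (Zb i)) / x.
  have -> : \tr (Zb i) = \sum_s p i s * \tr (Z i s).
    by rewrite raddf_sum /=; apply: eq_bigr => s _; rewrite mxtraceZ.
  rewrite -[in RHS](p_sum i) -[kap in RHS]mul1r -(p_sum i).
  rewrite mulr_suml -sumrB mulr_suml -sumrB; apply: eq_bigr => s _.
  by rewrite /c; ring.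
have trZb i : \tr (Zb i) <= kap.
  rewrite raddf_sum /= -[leRHS]mul1r -(p_sum i) mulr_suml.
  apply: ler_sum => s _; rewrite mxtraceZ.
  have := p_ge0 i s; rewrite le_eqVlt => /predU1P[<-|ps]; first by rewrite !mul0r.
  by rewrite ler_wpM2l ?(ltW ps) // trZ_le.
have cb0 i : 0 < \sum_s p i s * c i s by apply: weighted_sum_gt0.
have tE : pdef (t *: 1%:M : 'M[C]_n) by apply: pdefZ => //; exact: pdef1.
(* This is x 1 - d times the sum of the means, so the barrier ends exactly at x 1; the slack beyond
   t 1 is definite and only lowers the potential. *)
pose M0 := t *: 1%:M + d *: (1%:M - \sum_i Zb i).
have kd : kcone (d *: (1%:M - \sum_i Zb i)) by right; apply: pdefZ.
have aM0 : above determinant M0 by apply: above_add => //; exact: above_det.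
have M0E : M0 + d *: \sum_i Zb i = x *: 1%:M.
  by rewrite /M0 -addrA -scalerDr subrK -scalerDl -xtd.
pose L := [seq (\sum_s p i s * c i s, Zb i) | i <- index_enum 'I_m].
have hL : posdirops L by move=> _ /mapP[i _ ->]; split; [exact: cb0 | exact: dZb].
have phiL : {in L, forall y, logderiv y.2 determinant M0 <= y.1 - d^-1}.
  move=> _ /mapP[i _ ->] /=.
  have pb := pdef_psd (dZb i).
  have le1 := logderiv_mono (stable_det C n) (above_det tE) kd pb.
  apply: (le_trans le1).
  rewrite (@logderiv_det_eigen _ _ _ _ t) ?gt_eqF //; last first.
  - by rewrite -scalemxAl mul1mx.
  - exact: pdef_det_gt0.
  rewrite cbE -subr_ge0.
  (* Trace kap gives equality; a smaller trace leaves room, because its padding is charged at rate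
     1/x, not 1/t. *)
  have -> : 1 - (kap - \tr (Zb i)) / x - d^-1 - \tr (Zb i) / t =
            (kap - \tr (Zb i)) * (t^-1 - x^-1).
    rewrite er /t /x /d; field; rewrite r1 gt_eqF //.
  rewrite mulr_ge0 ?subr_ge0 // lef_pV2 ?posrE // xtd lerDl ltW //.
have [ab _] := barrier_iter hL aM0 d0 phiL.
rewrite big_map M0E in ab.
have [] := @select_all C n 'I_m S p c Z (x *: 1%:M) (index_enum 'I_m) [::]
  (index_enum_uniq _) _ p_ge0 dZ c0 cb0 dZb ab.
  by [].
move=> sel [psel asel]; exists sel; split.
  by move=> i; apply: psel; rewrite mem_index_enum.
apply: bound_of_blocks => [j|j].
  by rewrite mulmx_sumr mulmx_suml; apply: eq_bigr => i _; rewrite E_comm.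
(* In [c i - tr (V i) / x] the other blocks cancel, leaving 1 - (kap - tr (U i)) / x, and tr (U i)
   <= eps. Multiplied by x, this level is the final bound. *)
pose c1 := 1 - (kap - eps) / x.
have c1x : c1 * x = 1 + 2 * r + eps.
  by rewrite /c1 er /x; field.
have c10 : 0 < c1.
  rewrite -(pmulr_lgt0 _ x0) c1x addr_gt0 // addr_gt0 ?ltr01 // mulr_gt0 // ltr0n.
pose U i := E j *m Z i (sel i); pose V i := Z i (sel i) - E j *m Z i (sel i).
have UV i i' : U i *m V i' = 0.
  rewrite /U /V (E_comm i) -!mulmxA mulmxBr (mulmxA (E j) (E j)) E_idem.
  by rewrite subrr mulmx0.
have pU i : psd (U i) by apply: psd_block.
have pV i : psd (V i) by apply: psd_coblock.
have UVE i : U i + V i = Z i (sel i) by rewrite /U /V addrC subrK.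
have dUV i : pdef (U i + V i) by rewrite UVE.
have MV i : x *: 1%:M *m V i = x *: V i by rewrite -scalemxAl mul1mx.
have hr : foldr (fun i b => c i (sel i) - \tr (V i) / x <= c1 /\ b) True (index_enum 'I_m).
  elim: (index_enum _) => //= i js IH; split=> //.
  rewrite /c /c1 /V raddfB /= -subr_ge0.
  have -> : 1 - (kap - eps) / x - (1 - (kap - \tr (Z i (sel i))) / x -
     (\tr (Z i (sel i)) - \tr (E j *m Z i (sel i))) / x) =
     (eps - \tr (E j *m Z i (sel i))) / x by ring.
  rewrite divr_ge0 ?(ltW x0) // subr_ge0.
  by apply: tr_le; apply: psel; rewrite mem_index_enum.
have asel' : above (diropseq [seq (c i (sel i), U i + V i) | i <- index_enum 'I_m])
    (x *: 1%:M).
  have -> : [seq (c i (sel i), U i + V i) | i <- index_enum 'I_m] =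
            [seq (c i (sel i), Z i (sel i)) | i <- index_enum 'I_m].
    by apply: eq_map => i'; rewrite UVE.
  exact: asel.
have := psd_of_above (peel_dirops x0 c10 (fun i => c0 i (sel i)) pU pV dUV UV MV hr asel').
move/(psdZ (ltW c10)); rewrite scalerBr !scalerA c1x divff ?gt_eqF // scale1r.
by rewrite mulmx_sumr.
Qed.

End BlockSelection.

(** * Selection for semidefinite values, by perturbation *)

Section BlockSelectionLimit.
Local Open Scope sesquilinear_scope.
Variable C : numClosedFieldType.

Lemma psd_limit n (M : 'M[C]_n) : herm M ->
  (forall e, 0 < e -> psd (e *: 1%:M + M)) -> psd M.
Proof.
move=> hM h; split=> // x; rewrite real_leNgt ?real0 ?herm_qform_real //.
apply/negP => lt0.
have x0 : x != 0.
  by apply: contraTneq lt0 => ->; rewrite /qform mulmx0 mxE ltxx.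
have q1 := qform1_gt0 x0.
pose e := - qform M x / (2 * qform 1%:M x).
have e0 : 0 < e by rewrite divr_gt0 ?oppr_gt0 // mulr_gt0 // ltr0n.
have [_ /(_ x)] := h e e0; rewrite qformD qformZ.
have -> : e * qform 1%:M x + qform M x = qform M x / 2.
  by rewrite /e; field; rewrite gt_eqF.
by rewrite pmulr_lge0 ?invr_gt0 ?ltr0n // lt_geF.
Qed.

(** If each candidate failed for some e t, then d, which is below every e t, would have no
    candidate: success with d implies success with any larger number. *)
Lemma finite_psd_limit (T : finType) (P : pred T) n (M : T -> 'M[C]_n) :
  (forall t, herm (M t)) ->
  (forall e, 0 < e -> exists2 t, P t & psd (e *: 1%:M + M t)) ->
  exists2 t, P t & psd (M t).
Proof.
move=> hM h; apply: contrapT => no.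
have ex t : exists e, 0 < e /\ (P t -> ~ psd (e *: 1%:M + M t)).
  have [Pt|nPt] := boolP (P t); last by exists 1; rewrite ltr01.
  apply: contrapT => noe; apply: no; exists t => //; apply: psd_limit => // e e0.
  by apply: contrapT => np; apply: noe; exists e.
have {ex} [e he] := choice ex.
have e0 t : 0 < e t by case: (he t).
pose d := (1 + \sum_t (e t)^-1)^-1.
have s0 : 0 <= \sum_t (e t)^-1 by apply: sumr_ge0 => t _; rewrite invr_ge0 ltW.
have d0 : 0 < d by rewrite invr_gt0 ltr_wpDr // ltr01.
have [t Pt pt] := h d d0; have [_ /(_ Pt)] := he t; apply.
have le : d <= e t.
  rewrite -[leRHS]invrK lef_pV2 ?posrE ?invr_gt0 ?ltr_wpDr ?ltr01 //.
  rewrite (bigD1 t) //= addrCA lerDl addr_ge0 ?ler01 //.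
  by apply: sumr_ge0 => u _; rewrite invr_ge0 ltW.
have -> : e t *: 1%:M + M t = (e t - d) *: 1%:M + (d *: 1%:M + M t).
  by rewrite addrA -scalerDl subrK.
apply: psdD => //; apply: psdZ; first by rewrite subr_ge0.
exact/pdef_psd/pdef1.
Qed.

Lemma sqrtCD_le (a b : C) : 0 <= a -> 0 <= b -> sqrtC (a + b) <= sqrtC a + sqrtC b.
Proof.
move=> a0 b0; rewrite -(ler_pXn2r (n := 2)) ?nnegrE ?addr_ge0 ?sqrtC_ge0 ?addr_ge0 //.
rewrite sqrtCK sqrrD !sqrtCK [leRHS]addrAC lerDl.
by rewrite mulrn_wge0 // mulr_ge0 ?sqrtC_ge0.
Qed.

Variables (n m k : nat) (S : finType).
Variables (E : 'I_k -> 'M[C]_n) (p : 'I_m -> S -> C) (Z : 'I_m -> S -> 'M[C]_n) (eps : C).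

Theorem block_selection :
  (forall j, herm (E j)) -> (forall j, E j *m E j = E j) -> \sum_j E j = 1%:M ->
  (forall i s j, E j *m Z i s = Z i s *m E j) ->
  (forall i s, 0 <= p i s) -> (forall i, \sum_s p i s = 1) -> 0 < eps ->
  (forall i s j, 0 < p i s -> \tr (E j *m Z i s) <= eps) ->
  (forall i s, psd (Z i s)) ->
  psd (1%:M - \sum_i \sum_s p i s *: Z i s) ->
  exists sel : 'I_m -> S, (forall i, 0 < p i (sel i)) /\
    psd ((1 + 2 * sqrtC (eps * k%:R) + eps) *: 1%:M - \sum_i Z i (sel i)).
Proof.
move=> E_herm E_idem E_sum E_comm p_ge0 p_sum eps_gt0 tr_le pZ psum.
set b := 1 + _ + _.
have b0 : 0 < b.
  rewrite /b addr_gt0 // ltr_wpDr ?ltr01 // mulr_ge0 ?ler0n // sqrtC_ge0.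
  by rewrite mulr_ge0 ?ler0n // ltW.
have br : b \is Num.real by rewrite gtr0_real.
have hE j : 0 <= \tr (E j).
  rewrite -(E_idem j) -{1}(E_herm j).
  have -> : \tr ((E j)^t* *m E j) = \sum_r qform 1%:M (col r (E j)).
    rewrite /mxtrace; apply: eq_bigr => r _; rewrite qform1E mxE.
    by apply: eq_bigr => i _; rewrite !mxE normCK mulrC.
  by apply: sumr_ge0 => r _; exact: qform1_ge0.
(* Bounds the trace that the perturbation adds to a block. *)
have trE j : \tr (E j) <= n%:R.
  rewrite -(mxtrace1 C n) -E_sum raddf_sum /= (bigD1 j) //= lerDl.
  by apply: sumr_ge0 => l _.
suff [f pf] : exists2 f : {ffun 'I_m -> S}, [forall i, 0 < p i (f i)] &
    psd (b *: 1%:M - \sum_i Z i (f i)).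
  by exists f; split=> //; apply/forallP.
apply: finite_psd_limit => [f|e e0].
  apply: hermD; first by apply: hermZ => //; exact: herm1.
  rewrite -scaleN1r; apply: hermZ; rewrite ?realN ?real1 //.
  by apply: herm_sum => i _; case: (pZ i (f i)).
(* Without blocks the identity is an empty sum, so every matrix is 0 and any values of positive
   probability serve. *)
have [k0|k0] := posnP k.
  have z (M : 'M[C]_n) : M = 0.
    by rewrite -[M]mulmx1 -E_sum big1 ?mulmx0 // => j; have := ltn_ord j; rewrite {2}k0.
  have ex i : exists s, 0 < p i s.
    apply: contrapT => no; have := oner_neq0 C; rewrite -(p_sum i) big1 ?eqxx // => s _.
    have := p_ge0 i s; rewrite le_eqVlt => /predU1P[//|ps].
    by exfalso; apply: no; exists s.
  have [f hf] := choice ex.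
  exists [ffun i => f i]; first by apply/forallP => i; rewrite ffunE.
  by rewrite [X in psd X]z; exact: psd0.
(* The perturbation w^-1 (Z + tau 1) is definite and still satisfies the strict
   hypotheses; sg = sqrt tau keeps the loss linear in sg. *)
pose K : C := 2 * sqrtC (n%:R * k%:R) + n%:R.
pose K' : C := K + m.+1%:R * (b + K).
have K0 : 0 <= K by rewrite addr_ge0 ?ler0n // mulr_ge0 ?ler0n // sqrtC_ge0 mulr_ge0 ?ler0n.
have K'0 : 0 <= K' by rewrite addr_ge0 // mulr_ge0 ?ler0n // addr_ge0 // ltW.
(* The total loss is at most sg K' by [b'le]; this choice keeps it within e and sg within 1. *)
pose sg : C := e / (e + K').
have den : 0 < e + K' by rewrite ltr_wpDr.
have sg0 : 0 < sg by rewrite divr_gt0.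
have sg1 : sg <= 1 by rewrite ler_pdivrMr // mul1r lerDl.
have sgK : sg * K' <= e.
  by rewrite /sg mulrAC -mulrA ger_pMr // ler_pdivrMr // mul1r lerDr ltW.
pose tau : C := sg ^+ 2; have tau0 : 0 < tau by rewrite exprn_gt0.
have tau_sg : tau <= sg by rewrite /tau expr2 ger_pMr.
(* Dividing by 1 + m tau would only restore the bound on the means; one more tau makes it strict. *)
pose w : C := 1 + m.+1%:R * tau.
have w1 : 1 < w by rewrite ltrDl mulr_gt0 ?ltr0n.
have w0 : 0 < w by apply: lt_trans w1; exact: ltr01.
pose Z' i s := w^-1 *: (Z i s + tau *: 1%:M).
have dI : pdef (1%:M : 'M[C]_n) := pdef1 _ _.
have dZ' i s : pdef (Z' i s).
  by apply: pdefZ; rewrite ?invr_gt0 // addrC; apply: pdefD => //; exact: pdefZ.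
pose eps' : C := eps + n%:R * tau.
have eps'0 : 0 < eps' by rewrite ltr_wpDr // mulr_ge0 ?ler0n // ltW.
have [||||||||f [pf pbf]] := @block_selection_strict C n m k S E p Z' eps' E_herm E_idem E_sum.
- by move=> i s j; rewrite /Z' -scalemxAr -scalemxAl mulmxDr mulmxDl E_comm
    -scalemxAr -scalemxAl mulmx1 mul1mx.
- by [].
- by [].
- by [].
- move=> i s j ps; rewrite /Z' -scalemxAr mxtraceZ mulmxDr mxtraceD -scalemxAr mulmx1.
  rewrite mxtraceZ mulrC ler_pdivrMr //.
  apply: (@le_trans _ _ eps').
    by rewrite lerD ?tr_le // mulrC ler_wpM2r // ltW.
  by rewrite ler_peMr ?ltW.
- by [].
- by [].
- have e1 i : \sum_s p i s *: Z' i s = w^-1 *: (\sum_s p i s *: Z i s + tau *: 1%:M).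
    have -> : tau *: 1%:M = \sum_s p i s *: (tau *: 1%:M : 'M[C]_n).
      by rewrite -scaler_suml p_sum scale1r.
    rewrite -big_split scaler_sumr /=.
    by apply: eq_bigr => s _; rewrite /Z' -scalerDr !scalerA mulrC.
  have e2 : 1%:M - \sum_i \sum_s p i s *: Z' i s =
     (w^-1 * tau) *: 1%:M + w^-1 *: (1%:M - \sum_i \sum_s p i s *: Z i s).
    under eq_bigr do rewrite e1.
    rewrite -scaler_sumr big_split /= sumr_const card_ord -scaler_nat.
    set Y := \sum_i _; apply/matrixP => i j; rewrite !mxE.
    have : w != 0 by rewrite gt_eqF.
    rewrite /w mulrSr => w_neq0; field; exact: w_neq0.
  rewrite e2; apply: pdefD; first by apply: pdefZ => //; rewrite mulr_gt0 ?invr_gt0.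
  by apply: psdZ => //; rewrite invr_ge0 ltW.
exists [ffun i => f i]; first by apply/forallP => i; rewrite ffunE.
pose b' : C := 1 + 2 * sqrtC (eps' * k%:R) + eps'.
have e3 : \sum_i Z' i (f i) = w^-1 *: (\sum_i Z i (f i) + (m%:R * tau) *: 1%:M).
  rewrite /Z' -scaler_sumr big_split /= sumr_const card_ord -scaler_nat scalerA //.
have sg_ge0 : 0 <= sg := ltW sg0.
have tau_ge0 : 0 <= tau := ltW tau0.
have nk0 : 0 <= n%:R * k%:R :> C by rewrite mulr_ge0 ?ler0n.
have b'le : w * b' <= e + b.
  have le0 : sqrtC (eps' * k%:R) <= sqrtC (eps * k%:R) + sg * sqrtC (n%:R * k%:R).
    have -> : eps' * k%:R = eps * k%:R + tau * (n%:R * k%:R) by rewrite /eps'; ring.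
    apply: le_trans (sqrtCD_le _ (mulr_ge0 tau_ge0 nk0)) _.
      by rewrite mulr_ge0 ?ler0n // ltW.
    by rewrite lerD2l (sqrtCM tau_ge0 nk0) /tau sqrCK.
  have le1 : b' <= b + sg * K.
    rewrite -subr_ge0.
    have -> : b + sg * K - b' = 2 * (sqrtC (eps * k%:R) + sg * sqrtC (n%:R * k%:R)
        - sqrtC (eps' * k%:R)) + n%:R * (sg - tau).
      by rewrite /b /b' /K {2}/eps'; ring.
    by rewrite addr_ge0 ?mulr_ge0 ?ler0n ?subr_ge0.
  apply: (@le_trans _ _ (w * (b + sg * K))); first by rewrite ler_wpM2l // ltW.
  have le2 : m.+1%:R * tau * (b + sg * K) <= m.+1%:R * sg * (b + K).
    have sgK0 : 0 <= sg * K by apply: mulr_ge0.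
    apply: ler_pM.
    - by apply: mulr_ge0; rewrite ?ler0n.
    - by apply: addr_ge0 => //; exact: ltW.
    - by rewrite ler_wpM2l ?ler0n.
    - by rewrite lerD2l ler_piMl.
  rewrite mulrDl mul1r.
  apply: (@le_trans _ _ (b + sg * K + m.+1%:R * sg * (b + K))); first by rewrite lerD2l.
  have -> : b + sg * K + m.+1%:R * sg * (b + K) = sg * K' + b by rewrite /K'; ring.
  by rewrite lerD2r.
have -> : e *: 1%:M + (b *: 1%:M - \sum_i Z i ([ffun i => f i] i)) =
   (e + b - w * b' + m%:R * tau) *: 1%:M + w *: (b' *: 1%:M - \sum_i Z' i (f i)).
  under eq_bigr do rewrite ffunE.
  rewrite e3 scalerBr !scalerA divff ?gt_eqF // scale1r.
  by set Y := \sum_i _; apply/matrixP => i j; rewrite !mxE; ring.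
apply: psdD; last by apply: psdZ => //; exact: ltW.
apply: psdZ; last exact: pdef_psd.
by rewrite addr_ge0 ?subr_ge0 // mulr_ge0 ?ler0n // ltW.
Qed.

End BlockSelectionLimit.

Local Open Scope classical_set_scope.
Local Open Scope ring_scope.
Local Open Scope complex_scope.

(** * Block diagonal matrices and the projections onto their blocks *)

Section BlockDiagonal.
Local Open Scope sesquilinear_scope.
Variables (C : numClosedFieldType) (k d : nat).
Local Notation N := (\sum_(j < k) d)%N.
Implicit Types (B : 'I_k -> 'M[C]_d).

Lemma mxdiagM B B' : \mxdiag_j B j *m \mxdiag_j B' j = \mxdiag_j (B j *m B' j).
Proof.
rewrite {2}/mxdiag mul_mxdiag_mxblock /mxdiag; apply/eq_mxblock => i j.
case: eqP => [e|_]; last by rewrite mulmx0.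
by rewrite !conform_mx_id.
Qed.

Lemma trmxC_mxdiag B : (\mxdiag_j B j)^t* = \mxdiag_j (B j)^t*.
Proof.
rewrite tr_mxdiag; apply/matrixP => s t; rewrite !mxE.
by case: eqP => [e|_]; rewrite ?conform_mx_id !mxE ?conjC0.
Qed.

Lemma qform_mxdiag B (x : 'cV[C]_N) :
  qform (\mxdiag_j B j) x = \sum_j qform (B j) (submxcol x j).
Proof.
have e : x^t* = \mxrow_j (submxcol x j)^t*.
  by rewrite -{1}[x]submxcolK tr_mxcol; apply/matrixP => s t; rewrite !mxE.
rewrite /qform e -{2}[x]submxcolK -mulmxA mul_mxdiag_mxcol mul_mxrow_mxcol summxE.
by apply: eq_bigr => j _; rewrite mulmxA.
Qed.

Lemma psd_mxdiag B : (forall j, psd (B j)) -> psd (\mxdiag_j B j).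
Proof.
move=> h; split.
  by rewrite /herm trmxC_mxdiag; apply: eq_mxdiag => j; case: (h j).
by move=> x; rewrite qform_mxdiag; apply: sumr_ge0 => j _; case: (h j).
Qed.

Definition blockproj (j : 'I_k) : 'M[C]_N :=
  \mxdiag_l (if l == j then 1%:M else 0 : 'M[C]_d).

Lemma blockproj_herm j : herm (blockproj j).
Proof.
rewrite /herm trmxC_mxdiag; apply: eq_mxdiag => l.
by case: eqP => _; [exact: herm1 | exact: herm0].
Qed.

Lemma blockproj_mull j B :
  blockproj j *m \mxdiag_l B l = \mxdiag_l (if l == j then B l else 0).
Proof.
by rewrite mxdiagM; apply: eq_mxdiag => l; case: eqP; rewrite ?mul1mx ?mul0mx.
Qed.

Lemma blockproj_mulr j B :
  \mxdiag_l B l *m blockproj j = \mxdiag_l (if l == j then B l else 0).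
Proof.
by rewrite mxdiagM; apply: eq_mxdiag => l; case: eqP; rewrite ?mulmx1 ?mulmx0.
Qed.

Lemma blockproj_idem j : blockproj j *m blockproj j = blockproj j.
Proof. by rewrite blockproj_mull; apply: eq_mxdiag => l; case: eqP. Qed.

Lemma blockproj_sum : \sum_j blockproj j = 1%:M.
Proof.
rewrite -mxdiag_sum -(mxdiagZ 1); apply: eq_mxdiag => l.
by rewrite (bigD1 l) //= eqxx big1 ?addr0 // => j; rewrite eq_sym => /negPf ->.
Qed.

Lemma tr_blockproj j B : \tr (blockproj j *m \mxdiag_l B l) = \tr (B j).
Proof.
rewrite blockproj_mull mxtrace_mxdiag (bigD1 j) //= eqxx big1 ?addr0 // => l.
by move=> /negPf ->; rewrite mxtrace0.
Qed.

End BlockDiagonal.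

(** * The operator norm of a semidefinite matrix *)

Section OperatorNorm.
Local Open Scope sesquilinear_scope.
Variables (R : realType) (n : nat).
Implicit Types (A : 'M[R[i]]_n) (x : 'cV[R[i]]_n).

Lemma l2norm_qform x : (l2norm x ^+ 2)%:C = qform 1%:M x.
Proof.
rewrite qform1E /l2norm sqr_sqrtr; last by apply: sumr_ge0 => a _; rewrite sqr_ge0.
rewrite rmorph_sum; apply: eq_bigr => a _; rewrite rmorphXn.
by case: (x a 0).
Qed.

Lemma opnorm_le A (b : R) : 0 < b -> psd A -> psd (b%:C *: 1%:M - A) -> opnorm A <= b.
Proof.
move=> b0 pA pbA; have l2_ge0 x : 0 <= l2norm x by rewrite sqrtr_ge0.
have leb x : l2norm (A *m x) <= b * l2norm x.
  have bC0 : (0 : R[i]) < b%:C by rewrite ltcR.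
  have := qform1_mul_le x bC0 pA pbA.
  rewrite -!l2norm_qform -rmorphXn -rmorphM lecR -exprMn => le.
  by rewrite -(ler_pXn2r (n := 2)) ?nnegrE ?mulr_ge0 ?(ltW b0).
apply: ge_sup.
  exists (l2norm (A *m 0)), 0 => //; rewrite /mkset /l2norm big1 ?sqrtr0 ?ler01 // => a _.
  by rewrite mxE ComplexField.Normc.normc0 expr0n.
by move=> _ [x x1 <-]; apply: le_trans (leb x) _; rewrite ger_pMr.
Qed.

End OperatorNorm.

(** * Random variables with finitely many values *)

Section FiniteLaw.
Context {d : measure_display} {T : measurableType d} {R : realType}.
Variable P : probability T R.

Lemma expectation_finite (S : finType) (A : S -> set T) (g : S -> R) (f : T -> R) :
  (forall s, measurable (A s)) -> (forall w, exists s, A s w) ->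
  (forall w s s', A s w -> A s' w -> s = s') -> (forall w s, A s w -> f w = g s) ->
  'E_P[f]%E = (\sum_s g s * fine (P (A s)))%:E.
Proof.
move=> mA cov disj fg.
have -> : f = fun w => \sum_s g s * \1_(A s) w.
  apply/funext => w; have [s As] := cov w.
  rewrite (fg w s As) (bigD1 s) //= indicE mem_set // mulr1 big1 ?addr0 // => s' ss'.
  rewrite indicE memNset ?mulr0 // => As'.
  by rewrite (disj _ _ _ As As') eqxx in ss'.
rewrite unlock.
transitivity (\int[P]_w (\sum_s (g s)%:E * (\1_(A s) w)%:E))%E.
  by apply: eq_integral => w _; rewrite -sumEFin; apply: eq_bigr => s _; rewrite EFinM.
have iA s : P.-integrable setT (fun w => (\1_(A s) w)%:E).
  by apply: integrable_indic; exact: mA.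
rewrite integral_sum //; last by move=> s; exact: integrableZl.
rewrite -sumEFin; apply: eq_bigr => s _.
rewrite integralZl // integral_indic // setIT EFinM fineK //.
exact: fin_num_measure.
Qed.

Lemma measurable_borelmx1 n (M : 'M[R[i]]_n) : measurable ([set M] : set (borelmx R n)).
Proof.
have -> : [set M] = \bigcap_(ab in [set: 'I_n * 'I_n])
  (((fun M' : 'M[R[i]]_n => complex.Re (M' ab.1 ab.2)) @^-1` [set complex.Re (M ab.1 ab.2)]) `&`
   ((fun M' : 'M[R[i]]_n => complex.Im (M' ab.1 ab.2)) @^-1` [set complex.Im (M ab.1 ab.2)])).
  apply/seteqP; split => [_ -> [a b] _ //|M' h].
  apply/matrixP => a b; have [] := h (a, b) I.
  by rewrite /=; case: (M' a b) (M a b) => [x y] [x' y'] /= -> ->.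
apply: fin_bigcap_measurable => [|[a b] _]; first exact: finite_finset.
apply: measurableI; apply: sub_sigma_algebra; exists a, b.
  by exists [set complex.Re (M a b)] => //; left.
by exists [set complex.Im (M a b)] => //; right.
Qed.

End FiniteLaw.

(** * From the selection of values to the random matrices *)

Lemma psdmx_psd (R : realType) n (A : 'M[R[i]]_n) : psdmx A <-> psd A.
Proof. by split=> -[/herm_hermsymmx hA pA]; split=> //; apply/herm_hermsymmx. Qed.

Lemma mxdiag_scale (C : numClosedFieldType) (k d : nat) (c : C) (B : 'I_k -> 'M[C]_d) :
  c *: \mxdiag_j B j = \mxdiag_j (c *: B j).
Proof.
rewrite -mul_scalar_mx -mxdiagZ mxdiagM; apply: eq_mxdiag => j.
by rewrite mul_scalar_mx.
Qed.

Lemma sqrtC_real (R : realType) (x : R) : 0 <= x -> sqrtC x%:C = (Num.sqrt x)%:C.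
Proof.
move=> x0; rewrite -{1}(sqr_sqrtr x0) rmorphXn sqrCK // ler0c sqrtr_ge0 //.
Qed.

Theorem theorem1p2 (R : realType) (disp : measure_display)
    (T : measurableType disp) (P : probability T R)
    (eps : R) (d k m : nat)
    (X : 'I_m -> T -> 'M[R[i]]_(\sum_(j < k) d))
    (Xb : 'I_m -> 'I_k -> T -> 'M[R[i]]_d)
    (eps_gt0 : 0 < eps)
    (X_random : forall i, random_mx (X i))
    (X_indep : jointly_independent P
      (X : 'I_m -> T -> borelmx R (\sum_(j < k) d)))
    (X_psd : forall i w, psdmx (X i w))
    (X_finite : forall i, finite_set (range (X i)))
    (X_blocks : forall i w, X i w = \mxdiag_(j < k) Xb i j w)
    (Xb_random : forall i j, random_mx (Xb i j))
    (Xb_psd : forall i j w, psdmx (Xb i j w))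
    (sum_E_le : forall j, loewner_le (\sum_(i < m) expectation_mx P (Xb i j)) 1%:M)
    (tr_le : forall i j, {ae P, forall w, \tr (Xb i j w) <= eps%:C}) :
  (0 < P [set w | (opnorm (\sum_(i < m) X i w) <=
                   1 + 2 * Num.sqrt (eps * k%:R) + eps)%R])%E.
Proof.
(* One list holds the values of all the X i, since [block_selection] works with a single finite
   type. *)
have [us usE] : exists us : seq 'M[R[i]]_(\sum_(j < k) d),
    \bigcup_(i in [set: 'I_m]) range (X i) = [set` us].
  by apply/finite_seqP; apply: bigcup_finite => // *; exact: finite_finset.
have Xus i w : X i w \in us.
  by have : [set` us] (X i w) by rewrite -usE; exists i => //; exists w.
pose S := seq_sub us; pose A i (s : S) : set T := X i @^-1` [set ssval s].
pose b (s : S) j : 'M[R[i]]_d := submxblock (ssval s) j j.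
have sX (s : S) : exists i w, ssval s = X i w.
  have : [set` us] (ssval s) by exact: ssvalP.
  by rewrite -usE => -[i _ [w _ <-]]; exists i, w.
have bE s : ssval s = \mxdiag_j b s j.
  have [i [w e]] := sX s; rewrite e X_blocks; apply: eq_mxdiag => j.
  by rewrite /b e X_blocks submxblock_diag.
have pb s j : psd (b s j).
  have [i [w e]] := sX s; rewrite /b e X_blocks submxblock_diag.
  by apply/psdmx_psd.
have bX i j w s : A i s w -> Xb i j w = b s j.
  by rewrite /A /b /= => <-; rewrite X_blocks submxblock_diag.
have mA i s : measurable (A i s).
  rewrite -[A i s]setTI; apply: X_random => //; exact: measurable_borelmx1.
have covA i w : exists s, A i s w by exists (SeqSub (Xus i w)).
have disjA i w s s' : A i s w -> A i s' w -> s = s'.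
  by rewrite /A /= => -> /val_inj.
pose p i s : R[i] := (fine (P (A i s)))%:C.
clearbody b.
have pZ (s : S) : psd (ssval s) by rewrite bE; exact: (psd_mxdiag (pb s)).
have EE i j : expectation_mx P (Xb i j) = \sum_s p i s *: b s j.
  apply/matrixP => a c; rewrite mxE summxE.
  rewrite (expectation_finite P (g := fun s => complex.Re (b s j a c))
    (mA i) (covA i) (@disjA i)); last by move=> w s /bX ->.
  rewrite (expectation_finite P (g := fun s => complex.Im (b s j a c))
    (mA i) (covA i) (@disjA i)); last by move=> w s /bX ->.
  rewrite [LHS]complexE /= !rmorph_sum mulr_sumr -big_split /=.
  apply: eq_bigr => s _; rewrite mxE [b s j a c in RHS]complexE /p !rmorphM /=.
  by ring.
have PA i s : P (A i s) = (fine (P (A i s)))%:E by rewrite fineK // fin_num_measure.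
have p0 i s : 0 <= p i s by rewrite /p ler0c fine_ge0.
have p1 i : \sum_s p i s = 1.
  have := expectation_finite P (f := cst 1) (g := fun=> 1) (mA i) (covA i) (@disjA i).
  rewrite expectation_cst => /(_ (fun _ _ _ => erefl)) [] e.
  rewrite -(rmorph1 (real_complex R)) [X in _ = _ X]e rmorph_sum.
  by apply: eq_bigr => s _; rewrite mul1r.
have [|||||sel [selp selb]] := @block_selection R[i] _ m k S (@blockproj R[i] k d)
   p (fun _ s => ssval s) eps%:C (@blockproj_herm _ _ _) (@blockproj_idem _ _ _)
   (@blockproj_sum _ _ _) _ p0 p1.
- by move=> _ s j; rewrite bE blockproj_mull blockproj_mulr.
- by rewrite ltcR.
- move=> i s j; rewrite bE tr_blockproj /p ltcR => ps.
  (* The trace bound is almost sure, so a value violating it is taken on a negligible set only. *)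
  apply: contrapT => nle; move: ps; suff -> : P (A i s) = 0%E by rewrite ltxx.
  apply: measure_negligible => //.
  apply: negligibleS (tr_le i j) => w Aw /=.
  by rewrite (bX i j w s Aw).
- by move=> _ s; exact: pZ.
- have -> : 1%:M - \sum_i \sum_s p i s *: ssval s =
     \mxdiag_j (1%:M - \sum_i expectation_mx P (Xb i j)).
    rewrite mxdiagB (mxdiagZ 1) mxdiag_sum; congr (_ - _).
    apply: eq_bigr => i _; under eq_mxdiag do rewrite EE.
    rewrite mxdiag_sum; apply: eq_bigr => s _.
    by rewrite bE mxdiag_scale.
  by apply: psd_mxdiag => j; apply/psdmx_psd/sum_E_le.
set bd := 1 + 2 * Num.sqrt (eps * k%:R) + eps.
have bd0 : 0 < bd.
  by rewrite addr_gt0 // ltr_wpDr ?ltr01 // mulr_ge0 // sqrtr_ge0.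
have bdE : 1 + 2 * sqrtC (eps%:C * k%:R) + eps%:C = bd%:C.
  have -> : eps%:C * k%:R = (eps * k%:R)%:C by rewrite rmorphM rmorph_nat.
  rewrite sqrtC_real ?mulr_ge0 ?ler0n ?(ltW eps_gt0) //.
  by rewrite /bd !rmorphD rmorphM rmorph1 rmorph_nat.
rewrite bdE in selb.
(* On [G f] all the values are prescribed. The event of the theorem is a finite union of such sets,
   hence measurable. *)
pose G (f : {ffun 'I_m -> S}) := \bigcap_(i in [set` [set: 'I_m]%SET]) A i (f i).
have mG f : measurable (G f).
  by apply: fin_bigcap_measurable => [|i _]; [exact: finite_finset | exact: mA].
have GE f w : G f w -> \sum_i X i w = \sum_i ssval (f i).
  by move=> Gw; apply: eq_bigr => i _; apply: Gw; rewrite /= inE.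
set ev := [set w | _].
have evE : ev =
    \bigcup_(f in [set f : {ffun 'I_m -> S} | opnorm (\sum_i ssval (f i)) <= bd]) G f.
  apply/seteqP; split => w.
    move=> evw; have [f fw] := choice (fun i => covA i w).
    have Gw : G [ffun i => f i] w by move=> i _; rewrite ffunE; exact: fw.
    exists [ffun i => f i]; last exact: Gw.
    by rewrite /mkset -(GE _ _ Gw).
  by move=> [f /= le Gw]; rewrite /ev /= (GE _ _ Gw).
have mev : measurable ev.
  rewrite evE; apply: fin_bigcup_measurable => [|f _]; last exact: mG.
  exact: finite_finset.
pose f0 : {ffun 'I_m -> S} := [ffun i => sel i].
apply: (@lt_le_trans _ _ (P (G f0))); last first.
  apply: le_measure; rewrite ?inE // evE => w Gw; exists f0; last exact: Gw.
  have e : \sum_i ssval (f0 i) = \sum_i ssval (sel i).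
    by apply: eq_bigr => i _; rewrite ffunE.
  have le : opnorm (\sum_i ssval (sel i)) <= bd.
    by apply: (opnorm_le bd0 _ selb); apply: psd_sum => i _; exact: pZ.
  by rewrite /mkset e.
(* Independence makes the probability of the joint selection a product of positive factors. *)
rewrite (X_indep (fun i => [set ssval (f0 i)]) (fun i => measurable_borelmx1 (ssval (f0 i)))).
elim/big_ind: _ => [|x y|i _]; [exact: lte01 | exact: mule_gt0 |].
by rewrite -/(A i (f0 i)) PA lte_fin ffunE; have := selp i; rewrite /p ltcR.
Qed.
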